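(* For every $k$-bounded partition $\lambda$ and every $1\le i\le n-1$, $$\tilde g^{(k)}_{\lambda\cup R_i}(y|b)=\tilde g^{(k)}_{\lambda}(y|\omega^ib)\cdot\tilde g^{(k)}_{R_i}(y|b),$$ where $R_i=(i^{n-i})$ and $\lambda\cup R_i$ is the partition whose multiset of parts is the union of those of $\lambda$ and $R_i$.
   Context: Fix $n\ge2$, $k=n-1$. Let $R(T)=\mathbb{Z}[e^{\pm a_1},\dots,e^{\pm a_n}]/(e^{a_1+\cdots+a_n}-1)$; subscripts of $a_i,b_i$ are taken modulo $n$ with representatives in $\{1,\dots,n\}$; $b_i=1-e^{-a_i}$. Let $\hat\Lambda$ be the ring of symmetric formal power series in $y=(y_1,y_2,\dots)$ with coefficients in the fraction field of $R(T)$, and $\Omega(b_i|y)=\prod_{j\ge1}(1-b_iy_j)^{-1}$. For $1\le i\le n-1$, $s_i$ acts on $\hat\Lambda$ by exchanging $a_i,a_{i+1}$ in the coefficients; $s_\theta$ exchanges $a_1,a_n$ in the coefficients; $s_0(f)=\frac{\Omega(b_1|y)}{\Omega(b_n|y)}s_\theta(f)$. Put $\alpha_i=a_i-a_{i+1}$ ($1\le i\le n-1$), $\alpha_0=a_n-a_1$, $T_i=(1-e^{\alpha_i})^{-1}(s_i-1)$, $D_i=T_i+1$. These satisfy the braid relations of the affine symmetric group $\hat W$ generated by $s_0,\dots,s_{n-1}$, so $D_x$ is well defined via reduced words. $\hat W^0$ = minimal-length representatives of $\hat W/S_n$; $\tilde g^{(k)}_x(y|b)=D_x(1)$ for $x\in\hat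 W^0$. $\omega$ is the automorphism of $\hat\Lambda$ acting on coefficients by $a_i\mapsto a_{i+1}$, and $f(y|\omega^jb):=\omega^j(f(y|b))$. Partitions: a partition $\lambda$ is $k$-bounded if $\lambda_1\le k$; the $n$-residue of the box in row $r$, column $c$ is $c-r\bmod n$. $k$-bounded partitions are in bijection with $\hat W^0$ via $\lambda\mapsto x_\lambda=s_{i_1}\cdots s_{i_l}$, where the $(k+1)$-core associated with $\lambda$ (Lapointe–Morse bijection) is obtained from the empty partition by successively applying $s_{i_l},\dots,s_{i_1}$, $s_i$ adding all addable boxes of residue $i$; we write $\tilde g^{(k)}_\lambda=\tilde g^{(k)}_{x_\lambda}$. *)

(* Defs.v *)
From HB Require Import structures.
From mathcomp Require Import all_boot all_order all_algebra.
From mathcomp Require Import fraction.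
From mathcomp.multinomials Require Import mpoly.
Set Implicit Arguments. Unset Strict Implicit. Unset Printing Implicit Defensive.
Import Order.TTheory GRing.Theory Num.Theory.
Local Open Scope ring_scope.

(* Frac R(T).  R(T) = Z[e^{+-a_1},..,e^{+-a_n}]/(e^{a_1+..+a_n}-1) is the
   Laurent polynomial ring in e^{a_1},..,e^{a_{n-1}} (e^{a_n} being the inverse
   of their product), so its fraction field is the fraction field of
   Z[x_1,..,x_{n-1}], with x_j = e^{a_j}. *)
Definition Kfield (n : nat) := {fraction {mpoly int[n.-1]}}.

Definition Xv (n : nat) (l : 'I_n.-1) : Kfield n := tofrac ('X_l).
(* x_{j+1} for j < n-1 *)
Definition Xn (n j : nat) : Kfield n := oapp (@Xv n) 1 (insub j).

(* ea n j = e^{a_j}, subscript taken modulo n (residue 0 stands for a_n) *)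
Definition ea (n j : nat) : Kfield n :=
  let r := (j %% n)%N in
  if r == 0%N then (\prod_(l < n.-1) Xv l)^-1 else Xn n r.-1.

(* the ring automorphism of R(T) induced by e^{a_j} |-> e^{a_{pi j}} on
   Z[x_1..x_{n-1}], extended to the fraction field *)
Definition autK (n : nat) (pi : nat -> nat) (x : Kfield n) : Kfield n :=
  let g := mmap (fun z : int => z%:~R : Kfield n) (fun l : 'I_n.-1 => ea n (pi l.+1)) in
  g (\n_(repr x)) / g (\d_(repr x)).

Definition swapn (n a b : nat) (j : nat) : nat :=
  if (j %% n == a %% n)%N then b else if (j %% n == b %% n)%N then a else j.

(* A monomial y^alpha is encoded by its exponent sequence alpha (entry j is
   the exponent of y_{j+1}); sequences differing by trailing zeros encode the
   same monomial. A series is its coefficient function. *)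
Definition trimz (s : seq nat) : seq nat :=
  rev (drop (find (fun x => x != 0%N) (rev s)) (rev s)).

Definition series (n : nat) := seq nat -> Kfield n.

Fixpoint mdivs (s : seq nat) : seq (seq nat) :=
  if s is a :: t then [seq j :: u | j <- iota 0 a.+1, u <- mdivs t] else [:: [::]].

Definition msub (s t : seq nat) : seq nat := [seq (x.1 - x.2)%N | x <- zip s t].

Definition smul n (f g : series n) : series n := fun al =>
  \sum_(be <- mdivs al) f (trimz be) * g (trimz (msub al be)).
Definition sone n : series n := fun al => if trimz al == [::] then 1 else 0.
Definition scoef n (c : Kfield n -> Kfield n) (f : series n) : series n :=
  fun al => c (f al).

(* Omega(b|y) = prod_j (1 - b y_j)^{-1} = sum_alpha b^{|alpha|} y^alpha *)
Definition Omega n (b : Kfield n) : series n := fun al => b ^+ (sumn al).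
(* Omega(b|y)^{-1} = prod_j (1 - b y_j) *)
Definition Omega_inv n (b : Kfield n) : series n := fun al =>
  \prod_(x <- al) (if x == 0%N then 1 else if x == 1%N then - b else 0).

Definition bb n (i : nat) : Kfield n := 1 - (ea n i)^-1.

Definition s_act n (i : nat) (f : series n) : series n :=
  if i == 0%N then
    smul (smul (Omega (bb n 1)) (Omega_inv (bb n n))) (scoef (autK (swapn n 1 n)) f)
  else scoef (autK (swapn n i i.+1)) f.

Definition omega_s n (f : series n) : series n := scoef (autK (fun j => j.+1)) f.

Definition ealpha n (i : nat) : Kfield n :=
  if i == 0%N then ea n n / ea n 1 else ea n i / ea n i.+1.

Definition T_op n (i : nat) (f : series n) : series n :=
  fun al => (1 - ealpha n i)^-1 * (s_act i f al - f al).
Definition D_op n (i : nat) (f : series n) : series n :=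
  fun al => T_op i f al + f al.

Definition D_word n (w : seq nat) (f : series n) : series n := foldr (@D_op n) f w.

Definition is_partition (la : seq nat) : bool :=
  sorted geq la && all (fun x => 0 < x)%N la.
Definition k_bounded (k : nat) (la : seq nat) : bool := all (fun x => x <= k)%N la.

Definition residue (n r c : nat) : int := ((c%:Z - r%:Z) %% n%:Z)%Z.

Definition addable_row (la : seq nat) (r : nat) : bool :=
  (r <= size la)%N && ((r == 0%N) || (nth 0 la r < nth 0 la r.-1)%N).

Definition addable_i n (i : nat) (la : seq nat) (r : nat) : bool :=
  addable_row la r && (residue n r (nth 0 la r) == i%:Z).

Definition has_addable n (i : nat) (la : seq nat) : bool :=
  has (addable_i n i la) (iota 0 (size la).+1).

Definition add_res n (i : nat) (la : seq nat) : seq nat :=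
  trimz [seq (nth 0 la r + addable_i n i la r)%N | r <- iota 0 (size la).+1].

Definition core_of_word n (w : seq nat) : seq nat := foldr (add_res n) [::] w.

Fixpoint building_word n (w : seq nat) : bool :=
  if w is i :: w' then [&& (i < n)%N, building_word n w' & has_addable n i (core_of_word n w')]
  else true.

Definition conj_part (la : seq nat) (c : nat) : nat := count (fun x => c < x)%N la.
Definition hook (la : seq nat) (r c : nat) : nat :=
  (nth 0 la r - c + conj_part la c - r).-1.

(* Lapointe-Morse: k-bounded partition of a (k+1)-core, row r has as many
   boxes as there are boxes of hook length <= k in row r of the core *)
Definition kbounded_of_core (k : nat) (c : seq nat) : seq nat :=
  trimz [seq count (fun j => hook c r j <= k)%N (iota 0 (nth 0 c r)) | r <- iota 0 (size c)].

(* w is a reduced word of x_la, built as in the Lapointe-Morse bijection *)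
Definition word_of_partition n (w : seq nat) (la : seq nat) : bool :=
  building_word n w && (kbounded_of_core n.-1 (core_of_word n w) == la).

Definition gtilde n (w : seq nat) : series n := D_word w (@sone n).

Definition rect_part (n i : nat) : seq nat := nseq (n - i) i.
Definition part_union (la mu : seq nat) : seq nat := sort geq (la ++ mu).

(* Main.v *)
(* Let g be the function attached to R_i. Every D_j with j <> i fixes g, because
   x_{R_i} is the longest element of the parabolic subgroup omitting s_i, modulo S_n.
   Dividing g by H = prod_{j <= i} Omega(b_j), which satisfies the same relations
   s_j H = H for j <> i, gives coefficients fixed by all transpositions (a_j a_{j+1}),
   j <> i, hence by all of S_n. So s_i exchanging a_i and a_{i+1} multiplies g
   by Omega(b_{i+1}) / Omega(b_i), as it does H, and this is exactly what turns s_0,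
   shifted by omega^i, into s_i. Hence multiplication by g intertwines
   D_k with D_{k+i}:  D_{k+i}(omega^i(f) g) = omega^i(D_k f) g.  Applying this along a
   word of x_la, it remains to see that the word shifted by i, followed by a word of R_i,
   is a reduced word of x_{la \cup R_i}.  On bead configurations, passing from the core
   of la to that of la \cup R_i shifts the beads by i and removes the topmost bead of the i
   runners whose topmost bead is lowest; this operation commutes with the action of the
   letters, up to shifting them by i. *)

Require Import Defs.
From HB Require Import structures.
From mathcomp Require Import all_boot all_order all_algebra.
From mathcomp Require Import fraction generic_quotient.
From mathcomp.multinomials Require Import mpoly.
From mathcomp Require Import zify ring.
From Stdlib Require Import FunctionalExtensionality.
Set Implicit Arguments. Unset Strict Implicit. Unset Printing Implicit Defensive.
Import Order.TTheory GRing.Theory Num.Theory.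
Local Open Scope ring_scope.

(** * Affine reflections and reduced words *)

(** The three words in the theorem are arbitrary, so the argument needs a datum that forgets the
    word but still determines [gtilde]. This is the level function [lvl]: it counts beads instead of
    only recording them, it is permuted by the letters, and it determines the result for words in
    which every letter moves beads up. That is proved for abstract operators with commutation and
    braid relations, by an exchange argument. With idempotence and D_j(1) = 1 for 0 < j < n, the
    same argument shows that a letter moving no bead up fixes the result; this gives D_j g = g for j
    <> i. The obstacle to the relations of the D_j is the twist in s_0. Conjugation by H removes it,
    at the price of a twist in s_i, so i has to avoid the letters of the relation. This is possible
    for n >= 3, and for n = 2 the letters 0 and 1 satisfy no relation. The lowest runners are
    recognised by labels: along such words, the runners ordered by their topmost beads keep the
    order of their origins in the empty diagram. *)

Lemma dvdzDl (d m p : int) : (d %| m)%Z -> (d %| m + p)%Z = (d %| p)%Z.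
Proof. exact: rpredDl. Qed.

Section Reflections.
Variable n : nat.
Hypothesis hn : (2 <= n)%N.

Lemma dvdz_small (x : int) : (n %| x)%Z -> - n%:Z < x < n%:Z -> x = 0.
Proof.
move=> /dvdzP[q ->] H.
have [q0|q0|->] := ltgtP q 0; last by rewrite mul0r.
- have : q * n <= - 1%:Z * n by apply: ler_wpM2r; lia.
  lia.
- have : 1 * n%:Z <= q * n by apply: ler_wpM2r; lia.
  lia.
Qed.

(** The simple reflection s_k on positions. It exchanges k - 1 and k modulo n, rather than k and k +
    1, because adding a box of residue k moves a bead from k - 1 to k. *)
Definition sref (k p : int) : int :=
  if (n %| p - k)%Z then p - 1 else if (n %| p - k + 1)%Z then p + 1 else p.

Lemma ndvd_small (x : int) : - n%:Z < x < n%:Z -> x != 0 -> (n %| x)%Z = false.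
Proof. by move=> H x0; apply/negP=> /dvdz_small /(_ H) /eqP; rewrite (negPf x0). Qed.

Lemma srefE1 k : sref k k = k - 1.
Proof. by rewrite /sref subrr dvdz0. Qed.

Lemma srefE0 k : sref k (k - 1) = k.
Proof.
rewrite /sref; have -> : k - 1 - k = - 1 by lia.
rewrite (@ndvd_small (-1)); [|lia|lia].
by have -> : -1 + 1 = 0 :> int by []; rewrite dvdz0 subrK.
Qed.

Lemma sref_fix k p : (n %| p - k)%Z = false -> (n %| p - k + 1)%Z = false -> sref k p = p.
Proof. by rewrite /sref => -> ->. Qed.

Lemma sref_shift k p q : (n %| q)%Z -> sref k (p + q) = sref k p + q.
Proof.
move=> hq; rewrite /sref.
have -> : p + q - k + 1 = q + (p - k + 1) by lia.
have -> : p + q - k = q + (p - k) by lia.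
rewrite !(dvdzDl _ hq).
by case: ifP => _; [lia|case: ifP => _; lia].
Qed.

Lemma sref_mod k q p : (n %| q)%Z -> sref (k + q) p = sref k p.
Proof.
move=> hq; rewrite /sref.
have hq' : (n %| - q)%Z by rewrite rpredN.
have -> : p - (k + q) + 1 = - q + (p - k + 1) by lia.
have -> : p - (k + q) = - q + (p - k) by lia.
by rewrite !(dvdzDl _ hq').
Qed.

Lemma sref_add k p i : sref (k + i) (p + i) = sref k p + i.
Proof.
rewrite /sref; have -> : p + i - (k + i) = p - k by lia.
by case: ifP => _; [lia|case: ifP => _; lia].
Qed.

(* Every statement about sref is n-periodic; this reduces it to representatives. *)
Variant sref_spec k p : int -> Type :=
| SrefTop q of (n %| q)%Z & p = k + q : sref_spec k p (k - 1 + q)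
| SrefBot q of (n %| q)%Z & p = k - 1 + q : sref_spec k p (k + q)
| SrefFix of (n %| p - k)%Z = false & (n %| p - k + 1)%Z = false : sref_spec k p p.

Lemma srefP k p : sref_spec k p (sref k p).
Proof.
case h1: (n %| p - k)%Z.
  have -> : sref k p = k - 1 + (p - k) by rewrite /sref h1; lia.
  by apply: SrefTop => //; lia.
case h2: (n %| p - k + 1)%Z.
  have -> : sref k p = k + (p - k + 1) by rewrite /sref h1 h2; lia.
  by apply: SrefBot => //; lia.
have -> : sref k p = p by rewrite /sref h1 h2.
exact: SrefFix.
Qed.

Lemma srefK k : involutive (sref k).
Proof.
move=> p; case: (srefP k p) => [q hq ->|q hq ->|h1 h2].
- by rewrite sref_shift // srefE0.
- by rewrite sref_shift // srefE1.
- exact: sref_fix.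
Qed.

Lemma sref_adj k : (3 <= n)%N ->
  [/\ sref k (k + 1) = k + 1, sref (k + 1) (k - 1) = k - 1,
      sref (k + 1) k = k + 1 & sref (k + 1) (k + 1) = k].
Proof.
move=> hn3; split; last 2 first.
- by have := srefE0 (k + 1); rewrite addrK.
- by have := srefE1 (k + 1); rewrite addrK.
- apply: sref_fix; [have -> : k + 1 - k = 1 by lia|have -> : k + 1 - k + 1 = 2 by lia];
  by apply: ndvd_small; lia.
- apply: sref_fix; [have -> : k - 1 - (k + 1) = -2 by lia|
                    have -> : k - 1 - (k + 1) + 1 = -1 by lia];
  by apply: ndvd_small; lia.
Qed.

Lemma sref_braid k p : (3 <= n)%N ->
  sref k (sref (k + 1) (sref k p)) = sref (k + 1) (sref k (sref (k + 1) p)).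
Proof.
move=> /sref_adj - /(_ k) [A1 A2 A3 A4].
case: (srefP k p) => [q hq ->|q hq ->|h1 h2].
- by rewrite !(sref_shift _ _ hq, A1, A2, A3, A4, srefE0, srefE1).
- by rewrite !(sref_shift _ _ hq, A1, A2, A3, A4, srefE0, srefE1).
case: (srefP (k + 1) p) => [q hq ep|q hq ep|h3 h4].
- by rewrite addrK !(sref_shift _ _ hq, A1, A2, A3, A4, srefE0, srefE1).
- have e : (n %| p - k)%Z by have -> : p - k = q by lia.
  by rewrite h1 in e.
by rewrite !(@sref_fix k p) // sref_fix.
Qed.

Definition adj (k j : int) := (n %| j - k - 1)%Z.

Lemma sref_far k j : ~~ (n %| j - k)%Z -> ~~ adj k j -> ~~ adj j k ->
  sref k j = j /\ sref k (j - 1) = j - 1.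
Proof.
rewrite /adj => /negPf e0 /negPf e1 /negPf e2; split; apply: sref_fix => //.
- have -> : j - k + 1 = - (k - j - 1) by lia.
  by rewrite rpredN.
- by have -> : j - 1 - k = j - k - 1 by lia.
- by have -> : j - 1 - k + 1 = j - k by lia.
Qed.

Lemma sref_comm k j p : ~~ (n %| j - k)%Z -> ~~ adj k j -> ~~ adj j k ->
  sref k (sref j p) = sref j (sref k p).
Proof.
move=> h0 h1 h2; have h0' : ~~ (n %| k - j)%Z by rewrite -rpredN opprB.
have [b1 b2] := sref_far h0 h1 h2; have [b3 b4] := sref_far h0' h2 h1.
case: (srefP k p) => [q hq ->|q hq ->|g1 g2].
- by rewrite !(sref_shift _ _ hq, b1, b2, b3, b4, srefE0, srefE1).
- by rewrite !(sref_shift _ _ hq, b1, b2, b3, b4, srefE0, srefE1).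
case: (srefP j p) => [q hq _|q hq _|g3 g4].
- by rewrite !(sref_shift _ _ hq, b1, b2, b3, b4, srefE0, srefE1).
- by rewrite !(sref_shift _ _ hq, b1, b2, b3, b4, srefE0, srefE1).
by apply: sref_fix.
Qed.

(** Traces position p of the final diagram back to its origin in the empty diagram; the head of the
    word is the letter applied last, so it is undone first. *)
Fixpoint wpos (w : seq nat) (p : int) : int :=
  if w is k :: w' then wpos w' (sref k p) else p.

(* The state of a word: position p of the Maya diagram of the core of w carries a bead
   iff [lvl w p >= 0], and [lvl w p] is n times the number of beads strictly above p in
   its runner (negative if p lies above all of them). A letter k acts by permuting
   positions, and it adds boxes iff [lvl w k < lvl w (k - 1)]. *)
Definition lvl0 (p : int) : int := - n%:Z * ((p %/ n)%Z + 1).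
Definition lvl w p := lvl0 (wpos w p).

Lemma wpos_shift w p q : (n %| q)%Z -> wpos w (p + q) = wpos w p + q.
Proof. by move=> hq; elim: w p => //= k w IH p; rewrite sref_shift // IH. Qed.

Lemma wpos_inj w : injective (wpos w).
Proof. by elim: w => //= k w IH p p' /IH /(can_inj (srefK k)). Qed.

Lemma wpos_surj w q : exists p, wpos w p = q.
Proof.
elim: w => [|k w [p hp]] /=; first by exists q.
by exists (sref k p); rewrite srefK.
Qed.

Lemma lvl0_shift p q : (n %| q)%Z -> lvl0 (p + q) = lvl0 p - q.
Proof.
move=> /dvdzP[t ->]; rewrite /lvl0 [p + _]addrC divzMDl; last lia.
by ring.
Qed.

Lemma lvl_shift w p q : (n %| q)%Z -> lvl w (p + q) = lvl w p - q.
Proof. by move=> hq; rewrite /lvl wpos_shift // lvl0_shift. Qed.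

Lemma dvdz_lvl w p : (n %| lvl w p)%Z.
Proof. by rewrite /lvl /lvl0 dvdz_mulr // rpredN dvdzz. Qed.

Lemma lvl_cons k w p : lvl (k :: w) p = lvl w (sref k p).
Proof. by []. Qed.

(** Every letter moves beads up. This is the form in which a word is reduced and represents a
    minimal coset element, expressed by levels alone and without reference to a core. *)
Fixpoint ascending (w : seq nat) : bool :=
  if w is k :: w' then [&& (k < n)%N, ascending w' & lvl w' k < lvl w' (k%:Z - 1)] else true.

Lemma ascending_head k w : ascending (k :: w) -> lvl (k :: w) (k%:Z - 1) < lvl (k :: w) k.
Proof. by case/and3P=> _ _; rewrite !lvl_cons srefE0 srefE1. Qed.

(** For 0 <= j < n the quotient by n changes between j - 1 and j only at j = 0: the empty partition
    has an addable box of residue 0 and no other. *)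
Lemma lvl_nil (j : nat) : (j < n)%N ->
  (lvl [::] (j%:Z - 1) = lvl [::] j /\ j != 0%N) \/ (lvl [::] j < lvl [::] (j%:Z - 1) /\ j = 0%N).
Proof.
move=> hj; rewrite /lvl /lvl0 /=.
case: j hj => [|j] hj.
  right; split => //; rewrite div0z.
  have -> : 0%:Z - 1 = (-1) * n%:Z + (n.-1)%:Z by lia.
  by rewrite divzMDl ?divz_small; lia.
left; split => //; have -> : j.+1%:Z - 1 = j by lia.
by rewrite !divz_small //; lia.
Qed.


Lemma lvl_ascent w (k q : int) : (n %| q)%Z ->
  (lvl w (k + q) < lvl w (k + q - 1)) = (lvl w k < lvl w (k - 1)).
Proof.
by move=> hq; rewrite [k + q - 1]addrAC !(lvl_shift _ _ hq) ltrD2r.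
Qed.

Lemma lvl_descent w (k q : int) : (n %| q)%Z ->
  (lvl w (k + q - 1) < lvl w (k + q)) = (lvl w (k - 1) < lvl w k).
Proof.
by move=> hq; rewrite [k + q - 1]addrAC !(lvl_shift _ _ hq) ltrD2r.
Qed.

Lemma lvl_neutral w (k q : int) : (n %| q)%Z ->
  (lvl w (k + q - 1) = lvl w (k + q)) <-> (lvl w (k - 1) = lvl w k).
Proof.
by move=> hq; rewrite [k + q - 1]addrAC !(lvl_shift _ _ hq); split=> [/addIr|->].
Qed.

Lemma sref_congr (k j p : int) : (n %| j - k)%Z -> sref j p = sref k p.
Proof. by move=> /(sref_mod k p) <-; congr sref; lia. Qed.

(** * Abstract operators indexed by letters: exchange, uniqueness, stability *)

Section Operators.
Variables (X : Type) (good : X -> Prop) (D : nat -> X -> X) (x0 : X).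
Hypothesis good0 : good x0.
Hypothesis goodD : forall k x, good x -> good (D k x).
Hypothesis D_comm : forall (k j : nat) x, (k < n)%N -> (j < n)%N ->
  ~~ (n %| j%:Z - k%:Z)%Z -> ~~ adj k j -> ~~ adj j k -> good x -> D k (D j x) = D j (D k x).
Hypothesis D_braid : forall (k j : nat) x, (3 <= n)%N -> (k < n)%N -> (j < n)%N ->
  adj k j -> good x -> D k (D j (D k x)) = D j (D k (D j x)).

Definition run w := foldr D x0 w.

(** In the application [good] is [trimmed]: the relations between the operators hold only for
    functions that represent series. *)
Lemma good_run w : good (run w).
Proof. by elim: w => //= k w IH; apply: goodD. Qed.

Lemma lt_n_eq (k j : nat) : (k < n)%N -> (j < n)%N -> (n %| j%:Z - k%:Z)%Z -> j = k.
Proof. by move=> hk hj /dvdz_small H; have := H _; lia. Qed.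

(* For n = 2 the letters 0 and 1 are adjacent on both sides and satisfy no braid relation. *)
Lemma adj_ge3 w (k j : nat) : adj k j ->
  lvl w (k%:Z - 1) <= lvl w k -> lvl w (j%:Z - 1) <= lvl w j -> (3 <= n)%N.
Proof.
move=> /dvdzP[t et] h1; apply: contraTT; rewrite -ltnNge -ltNge => hn2.
have en : n = 2%N by lia.
have -> : j%:Z = k%:Z - 1 + (t + 1) * n%:Z by rewrite en in et *; lia.
have -> : k%:Z - 1 + (t + 1) * n%:Z - 1 = k%:Z + t * n%:Z by rewrite en; lia.
rewrite !(lvl_shift _ _ (dvdz_mull _ (dvdzz n))); lia.
Qed.

(* The exchange property together with Matsumoto's theorem: the diamond is closed with
   the braid relation, applied to the common lower bound reached after three steps. *)
Lemma descent_exchange w (j : nat) : ascending w -> (j < n)%N ->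
  lvl w (j%:Z - 1) < lvl w j ->
  exists w', [/\ size w = (size w').+1, ascending w', lvl w' =1 lvl w \o sref j
    & run w = D j (run w')].
Proof.
have [m] := ubnP (size w); elim: m w j => // m IH w j.
case: w => [|k w1] hs hw hj hd.
  by case: (lvl_nil hj) => [[e _]|[e _]]; move: hd e; lia.
have hk : (k < n)%N by case/and3P: hw.
have hw1 : ascending w1 by case/and3P: hw.
have hdk := ascending_head hw.
have U1 p : lvl w1 p = lvl (k :: w1) (sref k p) by rewrite lvl_cons srefK.
have [e|nkj] := boolP (n %| j%:Z - k%:Z)%Z.
  by rewrite (lt_n_eq hk hj e); exists w1; split.
have IH1 := fun j h => IH w1 j hs hw1 h.
have [hadj|nadj] := boolP (adj k j).
  have hn3 := adj_ge3 hadj (ltW hdk) (ltW hd).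
  have [A1 A2 A3 A4] := sref_adj k hn3.
  have [q hq ej] : exists2 q, (n %| q)%Z & j%:Z = k%:Z + 1 + q.
    by exists (j%:Z - k%:Z - 1) => //; lia.
  have sj p : sref j p = sref (k%:Z + 1) p by rewrite ej sref_mod.
  have hd' : lvl (k :: w1) k < lvl (k :: w1) (k%:Z + 1).
    by move: hd; rewrite ej lvl_descent // addrK.
  have [|w2 [sz2 hw2 U2 e2]] := IH1 j hj.
    by rewrite ej lvl_descent // addrK !U1 srefE1 A1; apply: lt_trans hdk hd'.
  have [||w3 [sz3 hw3 U3 e3]] := IH w2 k _ hw2 hk; first by move: hs; rewrite /= sz2; lia.
    by rewrite !U2 /= !sj A2 A3 !U1 srefE0 A1.
  (* The word is now equivalent to k j k w3, hence to j k j w3 by the braid relation; the witness is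
     the latter without its first letter. *)
  exists [:: k, j & w3]; split => //=; first by rewrite sz2 sz3.
  - rewrite hk hj hw3 /=; apply/andP; split.
      by rewrite ej lvl_ascent // addrK !U3 /= A1 srefE1 !U2 /= !sj A2 A4 !U1 srefE0 srefE1.
    rewrite !lvl_cons !sj A3 A2 !U3 /= A1 srefE0 !U2 /= !sj A4 A3 !U1 srefE1 A1.
    exact: lt_trans hdk hd'.
  - by move=> p; rewrite !lvl_cons U3 /= U2 /= U1 !sj sref_braid // !srefK.
  - by rewrite e2 e3 D_braid //; apply: good_run.
have [hadj|nadj'] := boolP (adj j k).
  have hn3 := adj_ge3 hadj (ltW hd) (ltW hdk).
  have [A1 A2 A3 A4] := sref_adj j hn3.
  have [q hq ek] : exists2 q, (n %| q)%Z & k%:Z = j%:Z + 1 + q.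
    by exists (k%:Z - j%:Z - 1) => //; lia.
  have sk p : sref k p = sref (j%:Z + 1) p by rewrite ek sref_mod.
  have hdk' : lvl (k :: w1) j < lvl (k :: w1) (j%:Z + 1).
    by move: hdk; rewrite ek lvl_descent // addrK.
  have [|w2 [sz2 hw2 U2 e2]] := IH1 j hj.
    by rewrite !U1 !sk A2 A3; apply: lt_trans hd hdk'.
  have [||w3 [sz3 hw3 U3 e3]] := IH w2 k _ hw2 hk; first by move: hs; rewrite /= sz2; lia.
    by rewrite ek lvl_descent // addrK !U2 /= srefE1 A1 !U1 !sk A2 A4.
  exists [:: k, j & w3]; split => //=; first by rewrite sz2 sz3.
  - rewrite hk hj hw3 /=; apply/andP; split.
      by rewrite !U3 /= !sk A2 A3 !U2 /= srefE0 A1 !U1 !sk A3 A4.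
    rewrite ek lvl_ascent // addrK !lvl_cons A1 srefE1 !U3 /= !sk A4 A2 !U2 /=.
    by rewrite srefE0 srefE1 !U1 !sk A2 A3; apply: lt_trans hd hdk'.
  - by move=> p; rewrite !lvl_cons U3 /= U2 /= U1 !sk -sref_braid // !srefK.
  - by rewrite e2 e3 -D_braid //; apply: good_run.
have njk : ~~ (n %| k%:Z - j%:Z)%Z by rewrite -rpredN opprB.
have P1 p : sref k (sref j p) = sref j (sref k p) by apply: sref_comm.
have [kj kj1] := sref_far nkj nadj nadj'.
have [jk jk1] := sref_far njk nadj' nadj.
have [|w2 [sz2 hw2 U2 e2]] := IH1 j hj; first by rewrite !U1 kj kj1.
exists (k :: w2); split => //=; first by rewrite sz2.
- rewrite hk hw2 /= !U2 /= jk jk1 !U1 srefE0 srefE1; exact: hdk.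
- by move=> p; rewrite lvl_cons U2 /= U1 P1 srefK.
- by rewrite e2 D_comm //; apply: good_run.
Qed.

(** The head of w is a descent of the common state, so exchange brings the same letter to the front
    of the other word and both can be shortened. A state without descents forces the empty word. *)
Lemma run_unique w w' : ascending w -> ascending w' -> lvl w =1 lvl w' -> run w = run w'.
Proof.
elim: w w' => [|k w IH] w' hw hw' e.
  case: w' hw' e => // j w' hw' e; have := ascending_head hw'.
  rewrite -!e; case/and3P: hw' => hj _ _.
  by case: (lvl_nil hj) => [[e' _]|[e' _]]; move: e'; lia.
case/and3P: (hw) => hk hw1 _.
have [|w2 [sz2 hw2 U2 e2]] := descent_exchange hw' hk.
  by rewrite -!e; apply: ascending_head.
rewrite e2 /=; congr D; apply: IH => // p.
by rewrite U2 /= -e lvl_cons srefK.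
Qed.

Hypothesis D0 : forall j, (0 < j < n)%N -> D j x0 = x0.
Hypothesis D_idem : forall j x, (j < n)%N -> good x -> D j (D j x) = D j x.

(** Equal levels at j - 1 and j mean that s_j stabilises the state. The operator is pushed inwards
    through the word, becoming a neighbouring letter at each braid relation, until it reaches x0 as
    a letter other than 0. *)
Lemma run_neutral w (j : nat) : ascending w -> (j < n)%N ->
  lvl w (j%:Z - 1) = lvl w j -> D j (run w) = run w.
Proof.
have [m] := ubnP (size w); elim: m w j => // m IH w j.
case: w => [|k w1] hs hw hj he.
  case: (lvl_nil hj) => [[_ j0]|[e _]]; first by rewrite /= D0 // lt0n j0.
  by move: e; rewrite he ltxx.
have hk : (k < n)%N by case/and3P: hw.
have hw1 : ascending w1 by case/and3P: hw.
have hdk := ascending_head hw.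
have U1 p : lvl w1 p = lvl (k :: w1) (sref k p) by rewrite lvl_cons srefK.
have [e|nkj] := boolP (n %| j%:Z - k%:Z)%Z.
  by move: he hdk; rewrite (lt_n_eq hk hj e) => ->; rewrite ltxx.
have hle : lvl (k :: w1) (j%:Z - 1) <= lvl (k :: w1) j by rewrite he.
have [hadj|nadj] := boolP (adj k j).
  have hn3 := adj_ge3 hadj (ltW hdk) hle.
  have [A1 A2 A3 A4] := sref_adj k hn3.
  have [q hq ej] : exists2 q, (n %| q)%Z & j%:Z = k%:Z + 1 + q.
    by exists (j%:Z - k%:Z - 1) => //; lia.
  have sj p : sref j p = sref (k%:Z + 1) p by rewrite ej sref_mod.
  have he' : lvl (k :: w1) k = lvl (k :: w1) (k%:Z + 1).
    by move: he; rewrite ej lvl_neutral // addrK.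
  have [|w2 [sz2 hw2 U2 e2]] := descent_exchange hw1 hj.
    by rewrite ej lvl_descent // addrK !U1 srefE1 A1 -he'.
  (* With w1 replaced by j w2, the product D_j D_k D_j becomes D_k D_j D_k; the letter k is neutral
     for w2, so the innermost D_k disappears and D_k D_j is left, as in the original word. *)
  rewrite /= e2 -D_braid //; last exact: good_run.
  rewrite (IH w2 k) //; first by move: hs; rewrite /= sz2; lia.
  by rewrite !U2 /= !sj A2 A3 !U1 srefE0 A1.
have [hadj|nadj'] := boolP (adj j k).
  have hn3 := adj_ge3 hadj hle (ltW hdk).
  have [A1 A2 A3 A4] := sref_adj j hn3.
  have [q hq ek] : exists2 q, (n %| q)%Z & k%:Z = j%:Z + 1 + q.
    by exists (k%:Z - j%:Z - 1) => //; lia.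
  have sk p : sref k p = sref (j%:Z + 1) p by rewrite ek sref_mod.
  have hdk' : lvl (k :: w1) j < lvl (k :: w1) (j%:Z + 1).
    by move: hdk; rewrite ek lvl_descent // addrK.
  have [|w2 [sz2 hw2 U2 e2]] := descent_exchange hw1 hj.
    by rewrite !U1 !sk A2 A3 he.
  rewrite /= e2 D_braid //; last exact: good_run.
  rewrite (IH w2 k) //; first by move: hs; rewrite /= sz2; lia.
  by rewrite ek lvl_neutral // addrK !U2 /= srefE1 A1 !U1 !sk A2 A4.
have njk : ~~ (n %| k%:Z - j%:Z)%Z by rewrite -rpredN opprB.
have [kj kj1] := sref_far nkj nadj nadj'.
rewrite /= -D_comm //; last exact: good_run.
by rewrite (IH w1 j) // !U1 kj kj1.
Qed.

(** Applied to a word of R_i, this makes every D_j with j <> i fix the function of R_i. A neutral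
    letter acts trivially, and a descent can be exchanged to the front, where idempotence absorbs
    it. *)
Lemma run_stable w (j : nat) : ascending w -> (j < n)%N ->
  lvl w (j%:Z - 1) <= lvl w j -> D j (run w) = run w.
Proof.
move=> hw hj; rewrite le_eqVlt => /orP[/eqP|] h; first exact: run_neutral.
have [w' [_ _ _ ->]] := descent_exchange hw hj h.
by apply: D_idem => //; apply: good_run.
Qed.

End Operators.
End Reflections.

(** * Cores as bead configurations *)

Lemma trimz_cons a t :
  trimz (a :: t) = if (a == 0%N) && (trimz t == [::]) then [::] else a :: trimz t.
Proof.
have revdrop (s : seq nat) : (rev (drop (find (fun x => x != 0%N) (rev s)) (rev s)) == [::])
    = ~~ has (fun x => x != 0%N) s.
  rewrite -size_eq0 size_rev size_drop size_rev subn_eq0 -(size_rev s).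
  by rewrite leqNgt -has_find has_rev.
rewrite revdrop /trimz rev_cons -cats1 find_cat has_rev.
case: ifP => h /=.
  rewrite andbF drop_cat -has_find has_rev h rev_cat /= //.
have -> : find (fun x => x != 0%N) (rev t) = size (rev t).
  by apply: hasNfind; rewrite has_rev h.
rewrite drop_cat ltnNge leq_addr /= addKn drop_size.
by case: eqP => //= ->.
Qed.

Lemma nth_trimz s r : nth 0%N (trimz s) r = nth 0%N s r.
Proof.
elim: s r => [|a t IH] r //; rewrite trimz_cons.
case: ifP => [/andP[/eqP-> /eqP e]|_]; last by case: r => //= r; apply: IH.
by case: r => //= r; rewrite -IH e nth_nil.
Qed.

(** Defined for all r: the empty rows beyond the partition supply the infinite sea of beads, and the
    empty partition occupies exactly the negative positions. *)
Definition bead (c : seq nat) (r : nat) : int := (nth 0%N c r)%:Z - r%:Z - 1.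
Definition noninc (c : seq nat) := forall r, (nth 0%N c r.+1 <= nth 0%N c r)%N.

Lemma noninc_le c r s : noninc c -> (r <= s)%N -> (nth 0%N c s <= nth 0%N c r)%N.
Proof.
move=> hc; elim: s => [|s IH]; first by rewrite leqn0 => /eqP->.
rewrite leq_eqVlt => /orP[/eqP-> //|h]; exact: leq_trans (hc s) (IH h).
Qed.

Lemma bead_lt c r s : noninc c -> (bead c s < bead c r) = (r < s)%N.
Proof.
move=> hc; have [h|h] := ltnP r s.
  by have := noninc_le hc (ltnW h); rewrite /bead; lia.
by have := noninc_le hc h; rewrite /bead; lia.
Qed.

Lemma bead_inj c : noninc c -> injective (bead c).
Proof.
move=> hc r s e; have := bead_lt r s hc; have := bead_lt s r hc.
by rewrite e ltxx; lia.
Qed.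

Lemma bead_succ c r s : noninc c -> bead c r + 1 = bead c s -> (0 < r)%N /\ s = r.-1.
Proof.
move=> hc e; have hs : (s < r)%N by rewrite -(bead_lt s r hc); lia.
by have := noninc_le hc (ltnW hs); move: e; rewrite /bead; lia.
Qed.

Definition rep (c : seq nat) (L : int -> int) :=
  forall p, 0 <= L p <-> exists r, p = bead c r.

Section Cores.
Variable n : nat.
Hypothesis hn : (2 <= n)%N.

Lemma nth_add_res i c r : nth 0%N (add_res n i c) r = (nth 0%N c r + addable_i n i c r)%N.
Proof.
rewrite /add_res nth_trimz; have [h|h] := ltnP r (size c).+1.
  by rewrite (nth_map 0%N) ?size_iota // nth_iota.
rewrite nth_default ?size_map ?size_iota // nth_default ?(ltnW h) //.
by rewrite /addable_i /addable_row leqNgt h.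
Qed.

Lemma noninc_add_res i c : noninc c -> noninc (add_res n i c).
Proof.
move=> hc r; rewrite !nth_add_res; have := hc r.
have : addable_i n i c r.+1 -> (nth 0%N c r.+1 < nth 0%N c r)%N by case/andP=> /andP[].
by case: (addable_i n i c r.+1) => [/(_ isT)|_] /=; lia.
Qed.

Lemma residueE (i : nat) r c : (i < n)%N ->
  (residue n r c == i%:Z) = (n %| c%:Z - r%:Z - i%:Z)%Z.
Proof.
move=> hi; by rewrite /residue -eqz_mod_dvd [(i%:Z %% n)%Z]modz_small; lia.
Qed.

(** A box can be added to a row when the position just above its bead is free, and only the bead of
    the previous row could occupy that position. *)
Lemma addable_iE (i : nat) c r : (i < n)%N -> noninc c ->
  addable_i n i c r = (n %| bead c r + 1 - i%:Z)%Z && ((r == 0%N) || (bead c r + 1 != bead c r.-1)).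
Proof.
move=> hi hc; rewrite /addable_i residueE // andbC.
have -> : bead c r + 1 - i%:Z = (nth 0%N c r)%:Z - r%:Z - i%:Z by rewrite /bead; lia.
congr (_ && _).
rewrite /addable_row; case: r => [|r] //=.
have := hc r; have [h|h] := ltnP r (size c); first by rewrite /bead; lia.
by rewrite /bead !nth_default //; lia.
Qed.

Lemma lvl_gap w p q : lvl n w p < lvl n w q -> lvl n w p + n%:Z <= lvl n w q.
Proof.
move=> h; have /dvdzP[t et] : (n %| lvl n w q - lvl n w p)%Z by rewrite rpredB ?dvdz_lvl.
have t1 : 0 < t * n%:Z by lia.
have : 1 * n%:Z <= t * n%:Z by apply: ler_wpM2r; [lia|rewrite pmulr_lgt0 in t1; lia].
by lia.
Qed.

Lemma rep_nil : rep [::] (lvl n [::]).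
Proof.
move=> p; rewrite /lvl /lvl0 /= /bead; split => [h|[r ->]].
  have hp : p < 0.
    rewrite ltNge; apply/negP; rewrite -(@divz_ge0 p n); last lia.
    move=> h0; have : n%:Z * 1 <= n%:Z * ((p %/ n)%Z + 1) by apply: ler_wpM2l; lia.
    by lia.
  by exists (`|p|.-1)%N; rewrite nth_nil; lia.
rewrite nth_nil mulNr oppr_ge0 pmulr_rle0; last lia.
have : ~~ (0 <= ((0%:Z - r%:Z - 1) %/ n)%Z) by rewrite divz_ge0; lia.
by lia.
Qed.

Lemma ascent_spread w (k p : int) : lvl n w k < lvl n w (k - 1) -> (n %| p - k)%Z ->
  lvl n w p + n%:Z <= lvl n w (p - 1).
Proof.
move=> h hp; apply: lvl_gap; have -> : p = k + (p - k) by lia.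
by rewrite lvl_ascent.
Qed.

Lemma has_addable_ascent (i : nat) w c : (i < n)%N -> noninc c -> rep c (lvl n w) ->
  has_addable n i c -> lvl n w i < lvl n w (i%:Z - 1).
Proof.
move=> hi hc hr /hasP[r _]; rewrite addable_iE // => /andP[hd hb].
have h1 : 0 <= lvl n w (bead c r) by apply/hr; exists r.
have h2 : lvl n w (bead c r + 1) < 0.
  rewrite ltNge; apply/negP => /hr[s es].
  have [r0 e] := bead_succ hc es.
  by move: hb; rewrite es e eqxx (gtn_eqF r0).
have := lvl_ascent hn w i hd.
have -> : i%:Z + (bead c r + 1 - i%:Z) = bead c r + 1 by lia.
by rewrite [bead c r + 1 - 1]addrK => <-; apply: lt_le_trans h2 h1.
Qed.

(** At an ascent, each bead on a position p congruent to i has a bead at p - 1 ([spread]). So no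
    bead would move down, and adding all addable boxes of residue i is the full exchange of the
    runners of i - 1 and i. *)
Lemma rep_add_res (i : nat) w c : (i < n)%N -> noninc c -> rep c (lvl n w) ->
  lvl n w i < lvl n w (i%:Z - 1) -> rep (add_res n i c) (lvl n (i :: w)).
Proof.
move=> hi hc hr hasc p.
have spread := ascent_spread hasc.
have nadd r : ~~ (n %| bead c r + 1 - i%:Z)%Z -> bead (add_res n i c) r = bead c r.
  move=> h; rewrite {1}/bead nth_add_res; have := addable_iE r hi hc.
  by rewrite (negPf h) => ->; rewrite addn0.
have addT r : (n %| bead c r + 1 - i%:Z)%Z ->
    bead (add_res n i c) r =
      if (r == 0%N) || (bead c r + 1 != bead c r.-1) then bead c r + 1 else bead c r.
  move=> h; rewrite {1}/bead nth_add_res; have := addable_iE r hi hc.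
  by rewrite h /= => ->; case: ifP => _; rewrite /bead; lia.
have n1 : (n %| 1)%Z = false by apply: ndvd_small; lia.
rewrite lvl_cons; case: (srefP hn i p) => [q hq ep|q hq ep|h1 h2].
- have dp : (n %| p - i%:Z)%Z by have -> : p - i%:Z = q by lia.
  have -> : i%:Z - 1 + q = p - 1 by lia.
  split => [/hr[r er]|[r er]].
    have hd : (n %| bead c r + 1 - i%:Z)%Z by rewrite -er subrK.
    have := addT r hd; case: ifP => [_ e|]; first by exists r; rewrite e -er subrK.
    move=> /negbT; rewrite negb_or negbK => /andP[r0 /eqP e] _.
    exists r.-1; rewrite nadd -?e -?er ?subrK //.
    have -> : p + 1 - i%:Z = (p - i%:Z) + 1 by lia.
    by rewrite dvdzDl // n1.
  have [hd|hd] := boolP (n %| bead c r + 1 - i%:Z)%Z.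
    move: (addT r hd); case: ifP => _ e; first by apply/hr; exists r; lia.
    apply: le_trans (_ : lvl n w p <= _); first by apply/hr; exists r; lia.
    by have := spread p dp; lia.
  apply: le_trans (_ : lvl n w p <= _); first by apply/hr; exists r; rewrite er nadd.
  by have := spread p dp; lia.
- have dp : (n %| p + 1 - i%:Z)%Z by have -> : p + 1 - i%:Z = q by lia.
  have -> : i%:Z + q = p + 1 by lia.
  have sp : lvl n w (p + 1) + n%:Z <= lvl n w p by have := spread _ dp; rewrite addrK.
  split => [h|[r er]].
    have /hr[r er] : 0 <= lvl n w p by lia.
    move/hr: h => [s es]; have [|r0 e] := @bead_succ c r s hc; first lia.
    exists r; rewrite addT -?er // es e eqxx /=.
    by rewrite (gtn_eqF r0).
  have [hd|hd] := boolP (n %| bead c r + 1 - i%:Z)%Z.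
    move: (addT r hd); case: ifP => [_|/negbT] e.
      move: dp; rewrite er e [bead c r + 1 + 1 - i%:Z]addrAC.
      by rewrite dvdzDl // n1.
    move: e; rewrite negb_or negbK => /andP[_ /eqP e] e'.
    by apply/hr; exists r.-1; lia.
  by have e := nadd r hd; move: hd; rewrite -e -er dp.
- split => [/hr[r er]|[r er]].
    by exists r; rewrite nadd // -er [p + 1 - i%:Z]addrAC h2.
  have [hd|hd] := boolP (n %| bead c r + 1 - i%:Z)%Z; last by apply/hr; exists r; rewrite -nadd.
  move: (addT r hd); case: ifP => _ e; last by apply/hr; exists r; lia.
  by move: h1; rewrite er e hd.
Qed.

Lemma rep_core w : building_word n w ->
  [/\ ascending n w, noninc (core_of_word n w) & rep (core_of_word n w) (lvl n w)].
Proof.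
elim: w => [|i w IH] /=; first by split => //; exact: rep_nil.
case/and3P => hi /IH[hw hc hr] ha; have hasc := has_addable_ascent hi hc hr ha.
by split; [rewrite hi hw|apply: noninc_add_res|apply: rep_add_res].
Qed.

End Cores.

(** * Bounded partitions determine cores; the order of the runners *)

Section Shapes.
Variable n : nat.
Hypothesis hn : (2 <= n)%N.

Lemma conj_part_gt c j r : noninc c -> (r < conj_part c j)%N = (j < nth 0%N c r)%N.
Proof.
elim: c r => [|a c IH] r hc; first by rewrite nth_nil.
have hc' : noninc c by move=> s; apply: (hc s.+1).
rewrite /conj_part /=; have [ja|ja] := ltnP j a; first by case: r => //= r; rewrite -IH.
have small s : (nth 0%N c s <= j)%N by apply: leq_trans ja; apply: (@noninc_le (a :: c) 0 s.+1 hc).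
have := IH 0%N hc'; rewrite [(j < _)%N]ltnNge small /= lt0n => /negbFE/eqP.
rewrite /conj_part => ->; rewrite addn0 ltn0; case: r => [|r] /=; first by rewrite ltnNge ja.
by rewrite ltnNge small.
Qed.

(* [la r] counts the boxes of row r of hook length < n; the remaining boxes of that row
   are exactly those lying above row [r + n - la r] of the core. *)
Definition core_rows (c la : nat -> nat) :=
  forall r, (la r < n)%N /\ c r = (c (r + n - la r) + la r)%N.

(** In a core the position n below a bead is again a bead, say of row s. The boxes of row r with
    hook length less than n are those beyond the end of row s, and comparing positions gives s = r +
    n - la r. *)
Lemma kbounded_rows c w : noninc c -> rep c (lvl n w) ->
  core_rows (nth 0%N c) (nth 0%N (kbounded_of_core n.-1 c)).
Proof.
move=> hc hr r; rewrite /kbounded_of_core nth_trimz.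
have [hs|hs] := ltnP r (size c); last first.
  rewrite nth_default ?size_map ?size_iota //; split; first lia.
  by rewrite !nth_default //; lia.
rewrite (nth_map 0%N) ?size_iota // nth_iota // add0n.
have /hr[s es] : 0 <= lvl n w (bead c r + (- n%:Z)).
  rewrite lvl_shift ?rpredN ?dvdzz //.
  have : 0 <= lvl n w (bead c r) by apply/hr; exists r.
  lia.
have rs : (r < s)%N by rewrite -(bead_lt _ _ hc); lia.
have cs := noninc_le hc (ltnW rs).
have -> : count (fun j => hook c r j <= n.-1)%N (iota 0 (nth 0%N c r))
        = (nth 0%N c r - nth 0%N c s)%N.
  have -> : count (fun j => hook c r j <= n.-1)%N (iota 0 (nth 0%N c r))
          = count (fun j => nth 0%N c s <= j)%N (iota 0 (nth 0%N c r)).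
    apply: eq_in_count => j; rewrite mem_iota add0n => /= hj.
    have h1 : (r < conj_part c j)%N by rewrite conj_part_gt.
    have h2 := conj_part_gt j s hc.
    have e : (nth 0%N c r + s = nth 0%N c s + r + n)%N by move: es; rewrite /bead; lia.
    rewrite /hook -[(c`_r)%R]/(nth 0%N c r).
    move: h2; case: (ltnP j (nth 0%N c s)) => h3 h2; first lia.
    by move/negbT: h2; rewrite -leqNgt; lia.
  rewrite -{1}(subnKC cs) iotaD count_cat.
  rewrite (eq_in_count (a2 := pred0)); last by move=> j; rewrite mem_iota /=; lia.
  rewrite count_pred0 add0n (eq_in_count (a2 := predT)) ?count_predT ?size_iota //.
  by move=> j; rewrite mem_iota /=; lia.
move: es; rewrite /bead => es; split; first lia.
have -> : (r + n - (nth 0%N c r - nth 0%N c s))%N = s by lia.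
by lia.
Qed.

(** Since la r < n, the recursion refers each row to a strictly later one, so the rows are
    determined from the bottom up. *)
Lemma core_rows_unique c c' la N : (forall r, (N <= r)%N -> c r = 0%N) ->
  (forall r, (N <= r)%N -> c' r = 0%N) -> core_rows c la -> core_rows c' la -> c =1 c'.
Proof.
move=> h h' hc hc' r; have [m] : exists m, (N <= r + m)%N by exists N; lia.
elim: m r => [|m IH] r hm; first by rewrite h ?h' //; lia.
have [h1 ->] := hc r; have [_ ->] := hc' r; congr (_ + _)%N.
have e : (r + n - la r = r.+1 + (n - la r).-1)%N by lia.
by apply: IH; lia.
Qed.

(** The largest hook length of R_i is n - 1, so R_i is a core and is its own bounded partition. *)
Lemma core_rows_rect i : (0 < i < n)%N ->
  core_rows (nth 0%N (rect_part n i)) (nth 0%N (rect_part n i)).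
Proof.
move=> hi r; rewrite /rect_part !nth_nseq.
by case: ifP => h; split; rewrite ?ifF; lia.
Qed.

(** The position p + L p is the topmost bead of the runner of p, so the set of beads already
    determines all levels. *)
Lemma lvl_unique (L L' : int -> int) :
  (forall p, (n %| L p)%Z) -> (forall p, (n %| L' p)%Z) ->
  (forall p q, (n %| q)%Z -> L (p + q) = L p - q) ->
  (forall p q, (n %| q)%Z -> L' (p + q) = L' p - q) ->
  (forall p, 0 <= L p <-> 0 <= L' p) -> L =1 L'.
Proof.
move=> d d' s s' e p; apply/eqP; rewrite eq_le -subr_ge0 -s' // -(subr_ge0 (L' p)) -s //.
have h1 : 0 <= L (p + L p) by rewrite s // subrr.
have h2 : 0 <= L' (p + L' p) by rewrite s' // subrr.
by rewrite (proj1 (e _) h1) (proj2 (e _) h2).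
Qed.

(** Applied to [wpos n w p], it names the runner of p by the runner of the empty diagram from which
    it originates. *)
Definition label (q : int) : nat := `|(q %% n)%Z|%N.

Lemma labelP q : (label q < n)%N /\ exists2 a : int, q = a * n%:Z + (label q)%:Z & (q %/ n)%Z = a.
Proof.
have h0 : 0 <= (q %% n)%Z by apply: modz_ge0; lia.
have h1 : (q %% n)%Z < n by apply: ltz_pmod; lia.
split; first by rewrite /label; lia.
exists (q %/ n)%Z => //; rewrite {1}(divz_eq q n) /label; lia.
Qed.

Lemma label_shift p q : (n %| q)%Z -> label (p + q) = label p.
Proof.
move=> /dvdzP[t ->]; rewrite /label; congr absz; rewrite addrC.
by rewrite modzMDl.
Qed.

Lemma label_eq p q : label p = label q -> (n %| p - q)%Z.
Proof.
move=> e; have [_ [a ea _]] := labelP p; have [_ [b eb _]] := labelP q.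
suff -> : p - q = (a - b) * n%:Z by rewrite dvdz_mull.
by move: ea eb; rewrite e; move: (label q) => l -> ->; ring.
Qed.

Lemma sref_lt k p p' : p < p' -> sref n k p < sref n k p' \/
  exists2 q, (n %| q)%Z & p = k - 1 + q /\ p' = k + q.
Proof.
have n1 x : (n %| x)%Z -> x != 1.
  have d1 : (n %| 1)%Z = false by apply: ndvd_small; lia.
  by move=> hx; apply/eqP => ex; rewrite ex d1 in hx.
move=> h; case: (srefP hn k p) => [q hq ep|q hq ep|h1 h2];
  case: (srefP hn k p') => [q' hq' ep'|q' hq' ep'|h3 h4]; try by left; lia.
- have [e|e] := eqVneq q q'; first by right; exists q => //; split=> //; rewrite e.
  by left; have := n1 (q' - q) (rpredB hq' hq); lia.
- left; rewrite lt_neqAle; apply/andP; split; last by lia.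
  apply: contraFneq h3 => e; suff -> : p' - k = q by []. lia.
- left; rewrite lt_neqAle; apply/andP; split; last by lia.
  apply: contraFneq h2 => e; suff -> : p - k + 1 = q' by []. lia.
Qed.

(** A reflection reverses only the pair k - 1, k and its translates. Along an ascending word these
    two positions have different levels after the letter, so they are never both topmost. *)
Lemma wpos_top_mono w p p' : ascending n w -> lvl n w p = 0 -> lvl n w p' = 0 -> p < p' ->
  wpos n w p < wpos n w p'.
Proof.
elim: w p p' => //= k w IH p p' hw hp hp' lt; have hw1 : ascending n w by case/and3P: hw.
case: (sref_lt k lt) => [h|[q hq [ep ep']]]; first exact: IH.
have := ascending_head hn hw; rewrite -(@lvl_descent _ hn _ _ q) //.
by rewrite [k%:Z + q - 1]addrAC -ep -ep' hp hp' ltxx.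
Qed.

Lemma label_lt w p p' : ascending n w -> p + lvl n w p < p' + lvl n w p' ->
  (label (wpos n w p) < label (wpos n w p'))%N.
Proof.
move=> hw; set x := p + _; set x' := p' + _ => lt.
have e y : lvl n w (y + lvl n w y) = 0 by rewrite lvl_shift ?dvdz_lvl // subrr.
have {lt} := wpos_top_mono hw (e p) (e p') lt.
(* The origin of a topmost bead lies in the block from -n to -1, so it is determined by its
   label. *)
have top y : wpos n w (y + lvl n w y) = (label (wpos n w y))%:Z - n%:Z.
  have := e y; rewrite {1}/lvl wpos_shift ?dvdz_lvl // => /eqP.
  rewrite -(label_shift (wpos n w y) (dvdz_lvl n w y)).
  set z := wpos n w y + _; have [_ [a ez ea]] := labelP z.
  rewrite /lvl0 ea mulf_eq0 oppr_eq0 => /orP[/eqP|/eqP ea1]; first lia.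
  have am1 : a = -1 by lia.
  by rewrite {1}ez am1 mulN1r addrC.
by rewrite !top; lia.
Qed.

End Shapes.

(** * Adding a maximal rectangle *)

Section Factor.
Variables (n i : nat).
Hypothesis hn : (2 <= n)%N.
Hypothesis hi : (0 < i < n)%N.

(** By [label_lt], the labels below i belong to the i runners whose topmost bead is lowest. *)
Definition low (q : int) : bool := (label n q < i)%N.
(* The state of the core of R_i, with the origin of positions moved to i. *)
Definition lvlR (q : int) : int := lvl0 n q - n%:Z * (low q)%:Z.

(** After subtraction of i, the n - i rows of length i give the beads from i - n to -1, and the
    empty rows give those below -n. *)
Lemma lvlR_ge0 q : (0 <= lvlR q) = (q < - n%:Z) || (i%:Z - n%:Z <= q < 0).
Proof.
have [lq [a eq ea]] := labelP hn q; rewrite /lvlR /lvl0 ea /low.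
move: (label n q) eq lq => l eq lq.
have nb (b : bool) : 0 <= n%:Z * b%:Z <= n%:Z by case: b; lia.
have {}nb := nb (l < i)%N.
have [a0|a0] := lerP 0 a.
  have h1 : 0 <= a * n%:Z by apply: mulr_ge0; lia.
  by rewrite mulNr mulrDr mulr1 mulrC; lia.
have [a1|a1] := eqVneq a (-1).
  by rewrite eq a1 addNr mulr0; case: (ltnP l i) nb => /=; lia.
have h1 : a * n%:Z <= -2 * n%:Z by apply: ler_wpM2r; lia.
by rewrite mulNr mulrDr mulr1 mulrC; lia.
Qed.

Lemma lvlR_shift p q : (n %| q)%Z -> lvlR (p + q) = lvlR p - q.
Proof. by move=> hq; rewrite /lvlR lvl0_shift // /low label_shift //; lia. Qed.

Lemma dvdz_lvlR p : (n %| lvlR p)%Z.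
Proof. by rewrite /lvlR /lvl0 rpredB ?dvdz_mulr ?rpredN ?dvdzz. Qed.

Lemma lvl_rect w : word_of_partition n w (rect_part n i) ->
  forall p, lvl n w (p + i%:Z) = lvlR p.
Proof.
case/andP=> /rep_core - /(_ hn) [hw hc hr] /eqP hk.
have rowsR := kbounded_rows hn hc hr; rewrite hk in rowsR.
have rows : nth 0%N (core_of_word n w) =1 nth 0%N (rect_part n i).
  pose N := (size (core_of_word n w) + n)%N.
  apply: (core_rows_unique (N := N) hn _ _ rowsR (core_rows_rect hn hi)) => r hN.
    by rewrite nth_default //; lia.
  by rewrite nth_default // size_nseq; lia.
suff E : lvl n w =1 (fun p => lvlR (p - i%:Z)) by move=> p; rewrite E addrK.
apply: (@lvl_unique n) => [p|p|p q hq|p q hq|p]; [exact: dvdz_lvl|exact: dvdz_lvlR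
  |exact: lvl_shift|by rewrite /= addrAC (lvlR_shift _ hq)|].
rewrite hr lvlR_ge0; split => [[r ->]|/orP h].
  by rewrite /bead rows nth_nseq; case: ifP; lia.
case: h => h.
  by exists (`|p| - 1)%N; rewrite /bead rows nth_nseq ifF; lia.
by exists (`|p - i%:Z| - 1)%N; rewrite /bead rows nth_nseq ifT; lia.
Qed.

(** With the origin moved to i, the positions j - 1 and j lie in one block of length n, where [low]
    can only switch from true to false. Only the letter i crosses between blocks. *)
Lemma rect_stable w (j : nat) : word_of_partition n w (rect_part n i) -> (j < n)%N -> j != i ->
  lvl n w (j%:Z - 1) <= lvl n w j.
Proof.
move=> hw hj ji; have E := lvl_rect hw.
have -> : j%:Z = (j%:Z - i%:Z) + i%:Z by lia.
set q := j%:Z - i%:Z; rewrite [q + i%:Z - 1]addrAC !E.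
have [lq [a eq ea]] := labelP hn q.
have l0 : label n q != 0%N.
  apply/eqP => l0; have : (n %| q)%Z by rewrite eq l0 addr0 dvdz_mull.
  by move/(dvdz_small hn); rewrite /q; lia.
have e1 : q - 1 = a * n%:Z + (label n q).-1%:Z by rewrite {1}eq; lia.
have d1 : ((q - 1) %/ n)%Z = a by rewrite e1 divzMDl ?divz_small; lia.
have l1 : label n (q - 1) = (label n q).-1.
  by rewrite e1 /label modzMDl modz_small; lia.
rewrite /lvlR /lvl0 d1 ea /low l1 lerD2l lerN2 ler_wpM2l //.
by case: (ltnP (label n q) i); case: (ltnP (label n q).-1 i) => //=; lia.
Qed.

Definition shiftw (w : seq nat) := [seq ((k + i) %% n)%N | k <- w].

Section Shifted.
Variable wR : seq nat.
Hypothesis hR : word_of_partition n wR (rect_part n i).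

Lemma wpos_shiftw w p : wpos n (shiftw w ++ wR) (p + i%:Z) = wpos n wR (wpos n w p + i%:Z).
Proof.
elim: w p => //= k w IH p.
have -> : sref n ((k + i) %% n)%N (p + i%:Z) = sref n (k%:Z + i%:Z) (p + i%:Z).
  apply: sref_congr => //; rewrite -modz_nat -eqz_mod_dvd.
  by rewrite modz_mod.
by rewrite sref_add // IH.
Qed.

Lemma lvl_shiftw w p : lvl n (shiftw w ++ wR) (p + i%:Z) = lvlR (wpos n w p).
Proof. by rewrite /lvl wpos_shiftw -(lvl_rect hR). Qed.

(** Adding R_i lowers the levels of the low runners by n. This could destroy an ascent only if k - 1
    were low and k were not, but the ascent gives the runner of k the smaller label. *)
Lemma ascending_shiftw w : ascending n w -> ascending n (shiftw w ++ wR).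
Proof.
elim: w => [_|k w IH hw] /=.
  by case/andP: hR => /rep_core; case.
case/and3P: (hw) => hk hw1 h; rewrite ltn_pmod ?IH //=; last lia.
have [q hq ->] : exists2 q : int, (n %| q)%Z & ((k + i) %% n)%N%:Z = k%:Z + i%:Z + q.
  exists (((k + i) %% n)%N%:Z - (k%:Z + i%:Z)); last lia.
  by rewrite -modz_nat -eqz_mod_dvd modz_mod.
rewrite lvl_ascent //; have -> : k%:Z + i%:Z - 1 = k%:Z - 1 + i%:Z by lia.
rewrite !lvl_shiftw /lvlR.
have hg := lvl_gap hn h.
have hl : (label n (wpos n w k) < label n (wpos n w (k%:Z - 1)))%N by apply: label_lt => //; lia.
have : low (wpos n w (k%:Z - 1)) -> low (wpos n w k) by rewrite /low; lia.
move: h; rewrite /lvl; case: (low _) => [/= h /(_ isT) -> |h _]; first lia.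
by case: (low _) => /=; lia.
Qed.


Lemma part_union_cat la : is_partition la -> exists A B, [/\ la = A ++ B,
  all (fun x => i <= x)%N A, all (fun x => x < i)%N B
  & part_union la (rect_part n i) = A ++ rect_part n i ++ B].
Proof.
case/andP=> hs _; pose P := (fun x => i <= x)%N.
have gt : transitive geq by move=> x y z /= h1 h2; apply: leq_trans h2 h1.
have ga : antisymmetric geq by move=> x y /=; lia.
exists (filter P la), (filter (predC P) la).
have sortA : pairwise geq (filter P la) by rewrite -sorted_pairwise // sorted_filter.
have sortB : pairwise geq (filter (predC P) la) by rewrite -sorted_pairwise // sorted_filter.
have memA x : x \in filter P la -> (i <= x)%N by rewrite mem_filter => /andP[].
have memB x : x \in filter (predC P) la -> (x < i)%N.
  by rewrite mem_filter => /andP[/= h _]; rewrite ltnNge.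
have AB : allrel geq (filter P la) (filter (predC P) la).
  by apply/allrelP => x y /memA hx /memB hy /=; lia.
split.
- apply: (sorted_eq gt ga) => //; last by rewrite perm_sym perm_filterC.
  by rewrite sorted_pairwise // pairwise_cat AB sortA sortB.
- by apply/allP.
- by apply/allP.
apply: (sorted_eq gt ga).
- by apply: sort_sorted => x y /=; lia.
- rewrite sorted_pairwise // !pairwise_cat sortA sortB allrel_catr AB /rect_part /= !andbT.
  apply/and3P; split.
  + by apply/allrelP => x y /memA hx /nseqP[-> _].
  + by apply/allrelP => x y /nseqP[-> _] /memB /ltnW.
  + by elim: (n - i)%N => //= m ->; rewrite andbT; apply/allP => y /nseqP[-> _] /=.
rewrite perm_sort perm_sym perm_catCA perm_sym perm_catC perm_cat2l perm_sym.
by rewrite perm_filterC.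
Qed.

(** * The core of the union, by rows and by beads *)

Section Rows.
Variables (w la wu : seq nat).
Hypothesis hla : is_partition la.
Hypothesis hw : word_of_partition n w la.
Hypothesis hu : word_of_partition n wu (part_union la (rect_part n i)).

Let c := core_of_word n w.
Let P := bead c.
Let L := lvl n w.
Let lab p := label n (wpos n w p).

(** By [core_rows_unique] it is enough to guess the rows and check the recursion. Here t is the
    number of parts of la that are at least i; the rows t, ..., t + n - i - 1 of the old core occur
    twice, once lengthened by i and once unchanged. *)
Lemma union_rows : exists t,
  [/\ forall r, (r < t)%N -> (i <= nth 0%N la r)%N,
      forall r, (t <= r)%N -> (nth 0%N la r < i)%N &
      forall r, nth 0%N (core_of_word n wu) r =
        if (r < t + (n - i))%N then (nth 0%N c r + i)%N else nth 0%N c (r - (n - i))].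
Proof.
have [A [B [eAB /allP hA /allP hB eu]]] := part_union_cat hla.
have [hwa hc hr] := rep_core hn (proj1 (andP hw)).
have rc := kbounded_rows hn hc hr; rewrite (eqP (proj2 (andP hw))) -/c in rc.
have [hwa' hc' hr'] := rep_core hn (proj1 (andP hu)).
have ru := kbounded_rows hn hc' hr'; rewrite (eqP (proj2 (andP hu))) eu in ru.
exists (size A).
have lA r : (r < size A)%N -> (i <= nth 0%N la r)%N.
  by move=> h; rewrite eAB nth_cat h; apply: hA; apply: mem_nth.
have lB r : (size A <= r)%N -> (nth 0%N la r < i)%N.
  move=> h; rewrite eAB nth_cat ifF; last lia.
  have [h1|h1] := ltnP (r - size A)%N (size B); first by apply: hB; apply: mem_nth.
  by rewrite nth_default //; lia.
split=> //.
set c' := (fun r => if (r < size A + (n - i))%N then (nth 0%N c r + i)%N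
                    else nth 0%N c (r - (n - i))).
apply: (@core_rows_unique n hn _ c' _ (size (core_of_word n wu) + size c + size A + n)%N _ _ ru).
- by move=> r h; rewrite nth_default //; lia.
- by move=> r h; rewrite /c' ifF ?nth_default //; lia.
move=> r; rewrite nth_cat nth_cat size_nseq /rect_part nth_nseq /c'.
have [rt|rt] := ltnP r (size A).
  have -> : nth 0%N A r = nth 0%N la r by rewrite eAB nth_cat rt.
  have := lA r rt; have [h1 h2] := rc r; rewrite h2.
  split => //; rewrite ifT; last lia.
  rewrite ifT; last lia.
  lia.
have [rT|rT] := ltnP (r - size A)%N (n - i)%N.
  split; first lia.
  rewrite ifT; last lia.
  rewrite ifF; last lia.
  by congr (nth 0%N c _ + _)%N; lia.
have -> : nth 0%N B (r - size A - (n - i)) = nth 0%N la (r - (n - i)).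
  by rewrite eAB nth_cat ifF; [congr nth|]; lia.
have := lB (r - (n - i))%N; have [h1 h2] := rc (r - (n - i))%N => h3.
split => //; rewrite !ifF; try lia.
by rewrite {1}h2; congr (nth 0%N c _ + _)%N; lia.
Qed.

(** By [union_rows] the new beads, shifted back by i, are P r for r < t + n - i and P r - n for r >=
    t. A topmost bead thus survives exactly when its row is less than t + n - i, and [boxed]
    identifies these with the runners of label at least i by counting rows against labels. *)
Lemma union_rep : rep (core_of_word n wu) (lvl n (shiftw w ++ wR)).
Proof.
have [hwa hc hr] := rep_core hn (proj1 (andP hw)).
have rc := kbounded_rows hn hc hr; rewrite (eqP (proj2 (andP hw))) -/c in rc.
have [t [lA lB eu]] := union_rows.
have PP r : exists2 s, P r = P s + n%:Z & (s + nth 0%N la r = r + n)%N.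
  have [h1 h2] := rc r; exists (r + n - nth 0%N la r)%N; last lia.
  by rewrite /P /bead {1}/c h2 /c; lia.
have Plt r s : (P s < P r) = (r < s)%N by apply: bead_lt.
have LP p : 0 <= L p <-> exists r, p = P r by apply: hr.
have above x y : L x = 0 -> x < y -> 0 <= L y -> (lab x < lab y)%N.
  by move=> h1 h2 h3; apply: label_lt => //; rewrite -/L; lia.
(* The window of positions strictly between x and x + n meets every other runner once. If x is
   topmost, the beads in it carry precisely the labels larger than that of x. *)
have lab_inj x y z : x < y < x + n%:Z -> x < z < x + n%:Z -> lab y = lab z -> y = z.
  move=> hy hz /(label_eq hn) d.
  have e : y = z + (wpos n w y - wpos n w z).
    by apply: (wpos_inj hn (w := w)); rewrite wpos_shift //; lia.
  have := dvdz_small hn d; lia.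
have lab_surj x (l : nat) : L x = 0 -> (lab x < l < n)%N ->
    exists r, x < P r < x + n%:Z /\ lab (P r) = l.
  move=> h1 h2; have [y ey] := wpos_surj hn w l%:Z.
  have d0 : (n %| x - y + ((y - x) %% n)%Z)%Z.
    have -> : x - y + ((y - x) %% n)%Z = - ((y - x) - ((y - x) %% n)%Z) by lia.
    by rewrite rpredN -eqz_mod_dvd modz_mod.
  pose z := x + ((y - x) %% n)%Z; have ez : z = y + (x - y + ((y - x) %% n)%Z) by rewrite /z; lia.
  have lz : lab z = l.
    by rewrite /lab ez wpos_shift // label_shift // ey /label modz_small; lia.
  have m0 : 0 <= ((y - x) %% n)%Z by apply: modz_ge0; lia.
  have m1 : ((y - x) %% n)%Z < n by apply: ltz_pmod; lia.
  have zx : z != x by apply/eqP => zx; move: lz; rewrite zx; lia.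
  have /LP[r er] : 0 <= L z.
    rewrite leNgt; apply/negP => Lz.
    have : (lab z < lab x)%N.
      apply: label_lt => //; rewrite -/L h1.
      have /dvdzP[a ea] := dvdz_lvl n w z; rewrite -/L in ea.
      have a1 : a < 0.
        by rewrite ltNge; apply: contraL Lz => a0; rewrite -leNgt ea mulr_ge0.
      have : a * n%:Z <= -1 * n%:Z by apply: ler_wpM2r; lia.
      by rewrite /z in ea *; lia.
    by rewrite lz; lia.
  by exists r; rewrite -er; split => //; rewrite /z in zx *; lia.
have boxed x r : x = P r -> L x = 0 -> (r < t + (n - i))%N = ~~ (lab x < i)%N.
  move=> ex Lx; have [rT|rT] := ltnP r (t + (n - i)).
    apply/esym; rewrite -leqNgt leqNgt; apply/negP => li.
    (* If lab x < i, at least n - i labels exceed it. Their beads lie in rows strictly between r -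
       (n - i) and r, because row r - (n - i) has part at least i and its bead is at x + n or
       higher: too few rows. *)
    have sub : {subset iota (lab x).+1 (n - (lab x).+1) <=
        [seq lab (P s) | s <- iota (r.+1 - (n - i)) (r - (r.+1 - (n - i)))]}.
      move=> l; rewrite mem_iota => hl.
      have [|s [hs <-]] := lab_surj x l Lx; first lia.
      apply: map_f; rewrite mem_iota.
      have sr : (s < r)%N by rewrite -Plt -ex; lia.
      suff : (r - (n - i) < s)%N || (r < n - i)%N by lia.
      have [|rni] := ltnP r (n - i); first by rewrite orbT.
      rewrite orbF -Plt; have [s' e1 e2] := PP (r - (n - i))%N.
      have lar : (i <= nth 0%N la (r - (n - i)))%N by apply: lA; lia.
      have : ~~ (r < s')%N by lia.
      by rewrite -Plt; lia.
    have := uniq_leq_size (iota_uniq _ _) sub; rewrite size_map !size_iota; lia.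
  apply/esym/negbTE; rewrite negbK ltnNge; apply/negP => li.
  have [s0 es0 ts0] : exists2 s0, (s0 + (n - i) = r)%N & (t <= s0)%N.
    by exists (r - (n - i))%N; lia.
  have [s' e1 e2] := PP s0.
  have las : (nth 0%N la s0 < i)%N by apply: lB.
  have rs' : P s' < P r by rewrite Plt; lia.
  have box s : s \in iota s0 (n - i) -> x < P s < x + n%:Z.
    rewrite mem_iota => hs; apply/andP; split; first by rewrite ex Plt; lia.
    have : ~~ (P s0 < P s) by rewrite Plt; lia.
    by lia.
  have us : uniq [seq lab (P s) | s <- iota s0 (n - i)].
    rewrite map_inj_in_uniq ?iota_uniq // => s s1 hs hs1 e.
    by apply: (bead_inj hc); apply: lab_inj (box _ hs) (box _ hs1) e.
  (* Conversely the n - i rows from s0 to r - 1 have their beads in the window, since la s0 < i, but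
     at most n - i - 1 labels exceed lab x. *)
  have sub : {subset [seq lab (P s) | s <- iota s0 (n - i)] <= iota (lab x).+1 (n - (lab x).+1)}.
    move=> l /mapP[s hs ->]; have hb := box s hs.
    have h1 : (lab x < lab (P s))%N.
      by apply: above; [| lia | apply/LP; exists s].
    have [h2 _] := labelP hn (wpos n w (P s)); rewrite -/(lab _) in h2.
    by rewrite mem_iota; lia.
  have := uniq_leq_size us sub; rewrite size_map !size_iota.
  have [lx _] := labelP hn (wpos n w x); rewrite -/(lab x) in lx.
  lia.
have eqPhi p : lvl n (shiftw w ++ wR) p = L (p - i%:Z) - n%:Z * (lab (p - i%:Z) < i)%N.
  by rewrite -[in LHS](subrK i%:Z p) lvl_shiftw.
have Lgap x : 0 <= L x -> L x = 0 \/ n%:Z <= L x.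
  have /dvdzP[a] := dvdz_lvl n w x; rewrite -/L => -> h.
  have a0 : 0 <= a by rewrite pmulr_lge0 in h; lia.
  have [->|an0] := eqVneq a 0; [left; lia|right].
  have : 1 * n%:Z <= a * n%:Z by apply: ler_wpM2r; lia.
  by lia.
have Lsub x : L (x - n%:Z) = L x + n%:Z.
  by rewrite /L lvl_shift ?rpredN ?dvdzz //; lia.
move=> p; rewrite eqPhi; set x := p - i%:Z; split.
  move=> h; have Lx0 : 0 <= L x by case: (_ < _)%N h; lia.
  have [r er] := proj1 (LP x) Lx0.
  have hb : bead (core_of_word n wu) r = P r + i%:Z \/ ~~ (r < t + (n - i))%N.
    have [rT|rT] := ltnP r (t + (n - i)); [left|by right].
    by rewrite /bead eu rT /P /bead; lia.
  have [rT|rT] := ltnP r (t + (n - i)).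
    by exists r; case: hb => [->|]; [rewrite /x in er; lia|rewrite rT].
  case: (Lgap x Lx0) => hx.
    by have := boxed x r er hx; move: h; rewrite hx; case: (lab x < i)%N => /=; lia.
  have /LP[s es] : 0 <= L (x + n%:Z) by rewrite /L lvl_shift ?dvdzz // -/L; lia.
  have ts : (t <= s)%N.
    rewrite leqNgt; apply/negP => st; have := lA s st; have [s' e1 e2] := PP s.
    have : s' = r by apply: (bead_inj hc); rewrite -/P; lia.
    by lia.
  (* Here x is not topmost, and it is reached from the bead x + n: the unlengthened copy of row s
     stands n - i rows further down. *)
  exists (s + (n - i))%N; rewrite /bead eu ifF; last lia.
  by rewrite addnK; move: es; rewrite /P /bead /x; lia.
case=> r er; move: er; rewrite /bead eu; case: ifP => rT er.
  have ex : x = P r by rewrite /P /bead /x; lia.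
  have Lx0 : 0 <= L x by apply/LP; exists r.
  case: (Lgap x Lx0) => hx; last by case: (_ < _)%N; lia.
  by have := boxed x r ex hx; rewrite rT hx => /esym/negPf ->; rewrite mulr0.
have ex : x = P (r - (n - i))%N - n%:Z by rewrite /P /bead /x; lia.
have : 0 <= L (P (r - (n - i))%N) by apply/LP; exists (r - (n - i))%N.
by rewrite ex Lsub; case: (_ < _)%N; lia.
Qed.

Lemma union_lvl : lvl n wu =1 lvl n (shiftw w ++ wR).
Proof.
have [_ _ hr] := rep_core hn (proj1 (andP hu)).
apply: (@lvl_unique n) => [p|p|p q hq|p q hq|p]; try exact: dvdz_lvl; try exact: lvl_shift.
by rewrite hr union_rep.
Qed.

End Rows.
End Shifted.
End Factor.

(** * Automorphisms of the coefficient field *)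

Lemma big_ord_head (R : comNzRingType) m (F : nat -> R) : (0 < m)%N ->
  \prod_(j < m) F j = F 0%N * \prod_(l < m.-1) F l.+1.
Proof. by case: m => // m _; rewrite big_ord_recl. Qed.

Lemma clear_denom_add (R : comNzRingType) (m m' p q h h' : R) :
  m * p = h -> m' * q = h' -> m * m' * (p + q) = h * m' + h' * m.
Proof. by move=> <- <-; ring. Qed.

Lemma mul_denom_sub (R : comNzRingType) (x y dx dy : R) :
  (x - y) * (dx * dy) = x * dx * dy - y * dy * dx.
Proof. by ring. Qed.

Section Field.
Variable n : nat.
Hypothesis hn : (2 <= n)%N.
Local Notation K := (Kfield n).
Local Notation P := {mpoly int[n.-1]}.

Lemma fracE (x : K) : x * tofrac (\d_(repr x)) = tofrac (\n_(repr x)).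
Proof.
set y := repr x; have -> : x = (\pi_(FracField.type P) y)%qT by rewrite reprK.
rewrite -[_ * _]/(FracField.mul _ _) !piE.
apply/eqmodP; rewrite /= FracField.equivfE /FracField.mulf.
have d0 := denom_ratioP y.
by rewrite !numden_Ratio ?mulf_neq0 ?oner_eq0 //= !mulr1 mulrC.
Qed.

Lemma eaS (l : 'I_n.-1) : ea n l.+1 = Xv l.
Proof.
rewrite /ea modn_small; last by have := ltn_ord l; lia.
by rewrite /= /Xn valK.
Qed.

Lemma Xv_neq0 l : Xv l != 0 :> K.
Proof. rewrite /Xv tofrac_eq0; apply/eqP => /(congr1 (mcoeff U_(l)%MM)).
by rewrite mcoeffX eqxx mcoeff0. Qed.

Lemma ea_mod j k : (j = k %[mod n])%N -> ea n j = ea n k.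
Proof. by rewrite /ea => ->. Qed.

Lemma ea_neq0 j : ea n j != 0.
Proof.
rewrite /ea; case: ifP => h; first by rewrite invr_eq0; apply/prodf_neq0 => l _; apply: Xv_neq0.
have hj : ((j %% n).-1 < n.-1)%N by have := ltn_pmod j (ltnW hn); lia.
by rewrite /Xn insubT /=; apply: Xv_neq0.
Qed.

Lemma ea0 : ea n 0 = (\prod_(l < n.-1) Xv l)^-1.
Proof. by rewrite /ea mod0n. Qed.

Lemma prod_Xv : \prod_(l < n.-1) Xv l = tofrac 'X_[\sum_(l < n.-1) U_(l)] :> K.
Proof.
rewrite -rmorph_prod; congr tofrac; elim/big_rec2: _ => [|l p m _ ->]; first by rewrite mpolyX0.
by rewrite mpolyXD.
Qed.

Lemma Xv_inj : injective (@Xv n).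
Proof.
move=> l l' /eqP; rewrite /Xv tofrac_eq => /eqP /(congr1 (mcoeff U_(l)%MM)).
rewrite !mcoeffX eqxx; case: eqP => // /(congr1 (fun m : 'X_{1.. n.-1} => m l)).
by rewrite !mnm1E eqxx; case: eqP.
Qed.

Lemma ea0_Xv l : ea n 0 != Xv l.
Proof.
rewrite ea0; apply/eqP => /(congr1 (fun x => x * \prod_(l < n.-1) Xv l)).
rewrite mulVf; last by apply/prodf_neq0 => k _; apply: Xv_neq0.
rewrite prod_Xv /Xv -rmorphM -mpolyXD -tofrac1 => /eqP; rewrite tofrac_eq -mpolyX0.
move=> /eqP /(congr1 (mcoeff 0%MM)); rewrite !mcoeffX eqxx; case: eqP => //.
by move=> /(congr1 (fun m : 'X_{1.. n.-1} => m l)); rewrite mnmDE mnm1E eqxx mnm0E.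
Qed.

Lemma ea_case j : (j = 0 %[mod n])%N \/ exists l : 'I_n.-1, (j = l.+1 %[mod n])%N.
Proof.
have hj := ltn_pmod j (ltnW hn); case e : (j %% n)%N hj => [|r] hj; first by left; rewrite mod0n.
have hr : (r < n.-1)%N by lia.
by right; exists (Ordinal hr); rewrite /= modn_small.
Qed.

Lemma ea_inj j k : ea n j = ea n k -> (j = k %[mod n])%N.
Proof.
case: (ea_case j) => [ej|[l ej]]; case: (ea_case k) => [ek|[l' ek]].
- by rewrite ej ek.
- by rewrite (ea_mod ej) (ea_mod ek) eaS => /eqP; rewrite (negPf (ea0_Xv _)).
- by rewrite (ea_mod ej) (ea_mod ek) eaS => /esym/eqP; rewrite (negPf (ea0_Xv _)).
- by rewrite (ea_mod ej) (ea_mod ek) !eaS ej ek => /Xv_inj ->.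
Qed.

Definition evalK (pi : nat -> nat) : P -> K :=
  mmap (fun z : int => z%:~R : K) (fun l : 'I_n.-1 => ea n (pi l.+1)).

HB.instance Definition _ pi := GRing.RMorphism.copy (evalK pi)
  (mmap (intr : int -> K) (fun l : 'I_n.-1 => ea n (pi l.+1))).


Lemma evalKD pi p q : evalK pi (p + q) = evalK pi p + evalK pi q.
Proof. exact: rmorphD. Qed.

Lemma evalKB pi p q : evalK pi (p - q) = evalK pi p - evalK pi q.
Proof. exact: rmorphB. Qed.

Lemma evalKM pi p q : evalK pi (p * q) = evalK pi p * evalK pi q.
Proof. exact: rmorphM. Qed.

Lemma evalK_X pi l : evalK pi 'X_l = ea n (pi l.+1).
Proof. by rewrite /evalK mmapX mmap1U. Qed.

Lemma autKE pi x : autK pi x = evalK pi (\n_(repr x)) / evalK pi (\d_(repr x)).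
Proof. by []. Qed.

(** A permutation of the indices modulo n together with its inverse, as maps on natural numbers
    since indices such as 0 and n are used interchangeably. *)
Definition modperm (pi pi' : nat -> nat) :=
  [/\ forall j k, (j = k %[mod n])%N -> (pi j = pi k %[mod n])%N,
      forall j k, (j = k %[mod n])%N -> (pi' j = pi' k %[mod n])%N,
      forall j, (pi (pi' j) = j %[mod n])%N & forall j, (pi' (pi j) = j %[mod n])%N].

Lemma modperm_sym pi pi' : modperm pi pi' -> modperm pi' pi.
Proof. by case. Qed.

(** The relation e^{a_1+...+a_n} = 1 is symmetric. This is why a permutation may send a free
    variable to e^{a_n}, the inverse of their product. *)
Lemma prod_ea_perm pi pi' : modperm pi pi' ->
  ea n (pi 0%N) * \prod_(l < n.-1) ea n (pi l.+1) = 1.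
Proof.
move=> [pm pm' pK pK']; have n0 : (0 < n)%N by exact: ltnW.
pose sg (q : nat -> nat) (j : 'I_n) : 'I_n := Ordinal (ltn_pmod (q j) n0).
have sgK : cancel (sg pi) (sg pi').
  move=> j; apply: val_inj; rewrite /= (pm' _ _ (modn_mod _ _)) pK' modn_small //.
have sgK' : cancel (sg pi') (sg pi).
  move=> j; apply: val_inj; rewrite /= (pm _ _ (modn_mod _ _)) pK modn_small //.
rewrite -(big_ord_head (fun j => ea n (pi j))) //.
transitivity (\prod_(j < n) ea n j); last first.
  rewrite (big_ord_head (ea n)) // ea0 [X in _ * X](eq_bigr (@Xv n)) => [|l _]; last exact: eaS.
  by rewrite mulVf //; apply/prodf_neq0 => l _; apply: Xv_neq0.
rewrite [RHS](reindex (sg pi)) /=; last by apply: onW_bij; exists (sg pi').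
by apply: eq_bigr => j _; apply: ea_mod; rewrite modn_mod.
Qed.

Lemma mpoly_ring_ind (Q : P -> Prop) :
  (forall c, Q c%:MP) -> (forall l, Q 'X_l) -> (forall p q, Q p -> Q q -> Q (p + q)) ->
  (forall p q, Q p -> Q q -> Q (p * q)) -> forall p, Q p.
Proof.
move=> QC QX QD QM; have Q1 : Q 1 by apply: QC.
have QXm m : Q 'X_[m].
  rewrite mpolyXE_id; elim/big_ind: _ => // l _.
  by elim: (m l) => [|k IH]; rewrite ?expr0 // exprS; apply: QM.
elim/mpolyind => [|c m p _ _ Qp]; first exact: (QC 0).
by apply: QD => //; rewrite -mul_mpolyC; apply: QM.
Qed.

(* Clearing denominators in evalK pi d produces a polynomial h on which the inverse
   permutation can act; this is how evalK pi is seen to be injective. *)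
Lemma evalK_inj pi pi' : modperm pi pi' -> forall d, (evalK pi d == 0) = (d == 0).
Proof.
move=> hpi d; apply/eqP/eqP => [|->]; last exact: rmorph0.
have [h [m [m0 h1 h2]]] : exists h m : P, [/\ evalK pi' m != 0,
    tofrac m * evalK pi d = tofrac h & evalK pi' m * tofrac d = evalK pi' h].
  elim/mpoly_ring_ind: d => [c|l|p q [h [m [m0 h1 h2]]] [h' [m' [m0' h1' h2']]]
      |p q [h [m [m0 h1 h2]]] [h' [m' [m0' h1' h2']]]].
  - exists c%:MP, 1; rewrite !rmorph1 oner_eq0 !mul1r /evalK !mmapC.
    by split=> //; rewrite -[in c%:MP](intz c) !rmorph_int.
  - have [pm pm' pK pK'] := hpi; case: (ea_case (pi l.+1)) => [e|[l' e]].
      exists 1, (\prod_(l < n.-1) 'X_l).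
      have ev : evalK pi' (\prod_(l < n.-1) 'X_l) = \prod_(l < n.-1) ea n (pi' l.+1).
        by rewrite rmorph_prod; apply: eq_bigr => k _; apply: evalK_X.
      rewrite ev evalK_X !rmorph1; split.
      + by apply/prodf_neq0 => k _; apply: ea_neq0.
      + rewrite (ea_mod e) ea0 rmorph_prod mulfV //.
        by apply/prodf_neq0 => k _; apply: Xv_neq0.
      rewrite -[RHS](prod_ea_perm (modperm_sym hpi)) mulrC; congr (_ * _).
      by rewrite -[tofrac _]/(Xv l) -eaS; apply: ea_mod; rewrite -(pm' _ _ e) pK'.
    exists 'X_l', 1; rewrite !rmorph1 oner_eq0 !mul1r !evalK_X; split=> //.
      by rewrite (ea_mod e) eaS.
    by rewrite -[tofrac _]/(Xv l) -eaS; apply: ea_mod; rewrite -(pm' _ _ e) pK'.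
  - exists (h * m' + h' * m), (m * m'); split.
    + rewrite evalKM.
      apply: mulf_neq0.
      exact: m0.
      exact: m0'.
    + by rewrite tofracM evalKD tofracD !tofracM; apply: clear_denom_add.
    + by rewrite evalKM tofracD evalKD !evalKM; apply: clear_denom_add.
  - exists (h * h'), (m * m'); split.
    + rewrite evalKM.
      apply: mulf_neq0.
      exact: m0.
      exact: m0'.
    + by rewrite !tofracM evalKM mulrACA h1 h1'.
    + by rewrite !evalKM tofracM mulrACA h2 h2'.
move=> e; move: h1; rewrite e mulr0 => /esym/eqP; rewrite tofrac_eq0 => /eqP eh.
by move: h2; rewrite eh rmorph0 => /eqP; rewrite mulf_eq0 (negPf m0) tofrac_eq0 => /eqP.
Qed.

Section Aut.
Variables pi pi' : nat -> nat.
Hypothesis hpi : modperm pi pi'.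

(** [autK] is defined by the representative that [repr] chooses; injectivity of [evalK pi] keeps
    denominators nonzero, so any fraction may be used instead. *)
Lemma autK_frac (a d : P) (x : K) : d != 0 -> x * tofrac d = tofrac a ->
  autK pi x = evalK pi a / evalK pi d.
Proof.
move=> d0 e; rewrite autKE.
have d0' := denom_ratioP (repr x); have e' := fracE x.
have E : \n_(repr x) * d = a * \d_(repr x).
  by apply/eqP; rewrite -tofrac_eq !tofracM -e -e' mulrAC.
apply/eqP; rewrite eqr_div; [|by rewrite (evalK_inj hpi)|by rewrite (evalK_inj hpi)].
by rewrite -!evalKM E.
Qed.

Lemma frac_subE (F : fieldType) (a b c d : F) : b != 0 -> d != 0 ->
  (a * d - c * b) / (b * d) = a / b - c / d.
Proof. by move=> h1 h2; field; rewrite ?h1 ?h2. Qed.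

Lemma evalK_neq0 d : d != 0 -> evalK pi d != 0.
Proof. by rewrite (evalK_inj hpi). Qed.

Lemma autK_additive : zmod_morphism (@autK n pi).
Proof.
move=> x y; have dx := denom_ratioP (repr x); have dy := denom_ratioP (repr y).
have ex := fracE x; have ey := fracE y.
rewrite (@autK_frac (\n_(repr x) * \d_(repr y) - \n_(repr y) * \d_(repr x))
  (\d_(repr x) * \d_(repr y))); first last.
- by rewrite tofracB !tofracM -ex -ey mul_denom_sub.
- exact: mulf_neq0.
rewrite !autKE evalKB !evalKM; apply: frac_subE; exact: evalK_neq0.
Qed.

Lemma autK_multiplicative : monoid_morphism (@autK n pi).
Proof.
split=> [|x y].
  rewrite (@autK_frac 1 1); [|exact: oner_neq0|exact: mul1r].
  by rewrite [evalK pi 1]rmorph1 divr1.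
have dx := denom_ratioP (repr x); have dy := denom_ratioP (repr y).
have ex := fracE x; have ey := fracE y.
rewrite (@autK_frac (\n_(repr x) * \n_(repr y)) (\d_(repr x) * \d_(repr y))).
- by rewrite !autKE !evalKM mulf_div.
- exact: mulf_neq0.
- by rewrite !tofracM -ex -ey mulrACA.
Qed.

Lemma autK_ea j : autK pi (ea n j) = ea n (pi j).
Proof.
have [pm pm' pK pK'] := hpi.
case: (ea_case j) => [e|[l e]]; rewrite (ea_mod e) (ea_mod (pm _ _ e)).
  have m0 : \prod_(l < n.-1) 'X_l != 0 :> P.
    by rewrite -tofrac_eq0 rmorph_prod; apply/prodf_neq0 => l _; apply: Xv_neq0.
  rewrite (@autK_frac 1 (\prod_(l < n.-1) 'X_l)).
  - rewrite [evalK pi 1]rmorph1 rmorph_prod (eq_bigr (fun l : 'I_n.-1 => ea n (pi l.+1))).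
      rewrite -[X in X / _](prod_ea_perm hpi) mulfK //.
      by apply/prodf_neq0 => k _; apply: ea_neq0.
    by move=> k _; apply: evalK_X.
  - exact: m0.
  rewrite ea0 rmorph_prod mulVf ?tofrac1 //.
  by apply/prodf_neq0 => k _; apply: Xv_neq0.
rewrite (@autK_frac 'X_l 1).
- by rewrite [evalK pi 1]rmorph1 divr1 evalK_X.
- exact: oner_neq0.
- by rewrite eaS tofrac1 mulr1.
Qed.

End Aut.

Lemma rmorph_ea_eq (f g : {rmorphism K -> K}) : (forall j, f (ea n j) = g (ea n j)) -> f =1 g.
Proof.
move=> h x; have d0 : tofrac (\d_(repr x)) != 0 :> K by rewrite tofrac_eq0 denom_ratioP.
have E (p : P) : f (tofrac p) = g (tofrac p).
  elim/mpoly_ring_ind: p => [c|l|p q e1 e2|p q e1 e2].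
  - by rewrite -(intz c) !rmorph_int.
  - by rewrite -[tofrac _]/(Xv l) -eaS h.
  - by rewrite !rmorphD e1 e2.
  - by rewrite !rmorphM e1 e2.
have -> : x = tofrac (\n_(repr x)) / tofrac (\d_(repr x)) by rewrite -fracE mulfK.
by rewrite !fmorph_div !E.
Qed.


Lemma modperm_swapn a b : modperm (swapn n a b) (swapn n a b).
Proof.
have M j k : (j = k %[mod n])%N -> (swapn n a b j = swapn n a b k %[mod n])%N.
  by rewrite /swapn => e; rewrite e; case: ifP => // _; case: ifP.
have I j : (swapn n a b (swapn n a b j) = j %[mod n])%N.
  rewrite /swapn; case: (eqVneq (j %% n)%N (a %% n)%N) => [ja|ja].
    by rewrite eqxx; case: eqP => [->|]; rewrite ?ja.
  by case: (eqVneq (j %% n)%N (b %% n)%N) => [jb|jb]; rewrite ?eqxx ?(negPf ja) ?(negPf jb).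
by split.
Qed.

Lemma modperm_succ : modperm (fun j => j.+1) (fun j => j + n.-1)%N.
Proof.
have e j : (j.+1 + n.-1 = j + n)%N by lia.
split=> [j k h|j k h|j|j].
- by rewrite -addn1 -modnDml h modnDml addn1.
- by rewrite -modnDml h modnDml.
- by rewrite -addSn e modnDr.
- by rewrite e modnDr.
Qed.

End Field.

(** * Multiplication of series *)

Lemma trimzK s : trimz (trimz s) = trimz s.
Proof.
elim: s => // a t IH; rewrite !trimz_cons; case: ifP => // h.
by rewrite trimz_cons IH h.
Qed.

Lemma trimz_cons_trimz a s : trimz (a :: trimz s) = trimz (a :: s).
Proof. by rewrite !trimz_cons trimzK. Qed.

Lemma sumn_trimz s : sumn (trimz s) = sumn s.
Proof.
elim: s => // a t IH; rewrite trimz_cons; case: ifP => [/andP[/eqP-> /eqP e]|_] /=.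
  by rewrite -IH e.
by rewrite IH.
Qed.

Lemma triangle_sum (R : nmodType) (G : nat -> nat -> R) a :
  \sum_(m < a.+1) \sum_(j < m.+1) G j (m - j)%N = \sum_(j < a.+1) \sum_(l < (a - j).+1) G j l.
Proof.
elim: a => [|a IH]; first by rewrite !big_ord1.
rewrite big_ord_recr /= {}IH [RHS](eq_bigr (fun j : 'I_a.+2 =>
    \sum_(l < a.+1 - j) G j l + G j (a.+1 - j)%N)) => [|j _]; last by rewrite big_ord_recr.
rewrite big_split /=; congr (_ + _); rewrite [RHS]big_ord_recr /= subnn big_ord0 addr0.
by apply: eq_bigr => j _; rewrite subSn // -ltnS.
Qed.

Section Convolution.
Variable K : comNzRingType.
Local Notation S := (seq nat -> K).
Implicit Types (f g h : S) (c d : K).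

(** The product taken one variable at a time, without trimming, so that the ring laws follow by
    induction on the exponent sequence. *)
Fixpoint conv f g (al : seq nat) : K :=
  if al is a :: t then
    \sum_(j < a.+1) conv (fun s => f ((j : nat) :: s)) (fun s => g ((a - j)%N :: s)) t
  else f [::] * g [::].

Lemma eq_conv f f' g g' al : f =1 f' -> g =1 g' -> conv f g al = conv f' g' al.
Proof.
elim: al f f' g g' => [|a t IH] f f' g g' ef eg /=; first by rewrite ef eg.
by apply: eq_bigr => j _; apply: IH => s.
Qed.

Lemma conv_mdivs f g al : \sum_(be <- mdivs al) f be * g (msub al be) = conv f g al.
Proof.
elim: al f g => [|a t IH] f g; first by rewrite /= big_seq1.
have -> : mdivs (a :: t) = flatten [seq [seq j :: u | u <- mdivs t] | j <- index_iota 0 a.+1].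
  by [].
rewrite big_flatten big_map big_mkord; apply: eq_bigr => j _; rewrite big_map.
exact: IH.
Qed.

Lemma conv_suml m (F : 'I_m -> S) g al :
  conv (fun s => \sum_(i < m) F i s) g al = \sum_(i < m) conv (F i) g al.
Proof.
elim: al F g => [|a t IH] F g /=; first by rewrite mulr_suml.
rewrite exchange_big /=; apply: eq_bigr => j _; exact: IH.
Qed.

Lemma convC f g al : conv f g al = conv g f al.
Proof.
elim: al f g => [|a t IH] f g /=; first by rewrite mulrC.
rewrite (reindex_inj rev_ord_inj) /=; apply: eq_bigr => j _.
by rewrite IH subSS subKn // -ltnS.
Qed.

Lemma conv_sumr m (F : 'I_m -> S) g al :
  conv g (fun s => \sum_(i < m) F i s) al = \sum_(i < m) conv g (F i) al.
Proof. by rewrite convC conv_suml; apply: eq_bigr => i _; rewrite convC. Qed.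

Lemma convA f g h al : conv f (conv g h) al = conv (conv f g) h al.
Proof.
elim: al f g h => [|a t IH] f g h /=; first by rewrite mulrA.
under eq_bigr do rewrite conv_sumr.
under [RHS]eq_bigr do rewrite conv_suml.
pose G j l := conv (conv (fun s => f (j :: s)) (fun s => g (l :: s)))
  (fun s => h ((a - j - l)%N :: s)) t.
transitivity (\sum_(j < a.+1) \sum_(l < (a - j).+1) G j l).
  by apply: eq_bigr => j _; apply: eq_bigr => l _; rewrite IH.
rewrite -triangle_sum; apply: eq_bigr => m _; apply: eq_bigr => j _.
apply: eq_conv => // s; congr (h (_ :: _)).
by rewrite -subnDA subnKC // -ltnS.
Qed.

Lemma conv_lin c d f g g' al :
  conv f (fun s => c * g s + d * g' s) al = c * conv f g al + d * conv f g' al.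
Proof.
elim: al f g g' => [|a t IH] f g g' /=; first by ring.
by rewrite !mulr_sumr -big_split /=; apply: eq_bigr => j _; apply: IH.
Qed.

Lemma conv_scale c d f g al :
  conv (fun s => c * f s) (fun s => d * g s) al = (c * d) * conv f g al.
Proof.
elim: al f g => [|a t IH] f g /=; first by ring.
by rewrite mulr_sumr; apply: eq_bigr => j _; apply: IH.
Qed.

Lemma conv_zero f al : conv (fun=> 0) f al = 0.
Proof.
by elim: al f => [|a t IH] f /=; rewrite ?mul0r // big1.
Qed.

Definition unit_series : S := fun al => if trimz al == [::] then 1 else 0.

Lemma conv_one f al : conv unit_series f al = f al.
Proof.
elim: al f => [|a t IH] f /=; first by rewrite /unit_series /= mul1r.
rewrite big_ord_recl /= big1 ?addr0 => [|j _]; last first.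
  rewrite (eq_conv (f' := fun=> 0) (g' := fun s => f ((a - bump 0 j)%N :: s))) ?conv_zero //.
  by move=> s; rewrite /unit_series trimz_cons.
rewrite subn0 -[RHS](IH (fun s => f (a :: s))); apply: eq_conv => // s.
by rewrite /unit_series trimz_cons eqxx /=; case: (trimz s).
Qed.

Lemma conv_map (phi : {rmorphism K -> K}) f g al :
  phi (conv f g al) = conv (phi \o f) (phi \o g) al.
Proof.
elim: al f g => [|a t IH] f g /=; first by rewrite rmorphM.
by rewrite rmorph_sum; apply: eq_bigr => j _; rewrite IH.
Qed.

(* Only trimmed functions represent genuine series in y; [smul] always returns one. *)
Definition trimmed f := f \o trimz = f.

Lemma trimmedE f al : trimmed f -> f (trimz al) = f al.
Proof. by move=> /(congr1 (fun F => F al)). Qed.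

Lemma trimmedI f : (forall al, f (trimz al) = f al) -> trimmed f.
Proof. by move=> h; apply: functional_extensionality => al; apply: h. Qed.

Lemma trimmed_comp f : trimmed (f \o trimz).
Proof. by apply: trimmedI => al /=; rewrite trimzK. Qed.

Lemma trimmed_cons f j : trimmed f -> trimmed (fun s => f (j :: s)).
Proof.
by move=> hf; apply: trimmedI => s; rewrite -(trimmedE _ hf) trimz_cons_trimz trimmedE.
Qed.

Lemma conv_trimz f g al : trimmed f -> trimmed g -> conv f g (trimz al) = conv f g al.
Proof.
elim: al f g => [|a t IH] f g hf hg //; rewrite trimz_cons.
case: ifP => [/andP[/eqP-> /eqP e]|_] /=; last first.
  by apply: eq_bigr => j _; apply: IH; apply: trimmed_cons.
rewrite big_ord1 subnn -IH; try exact: trimmed_cons.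
by rewrite e /= -(trimmedE [:: 0%N] hf) -(trimmedE [:: 0%N] hg).
Qed.

Definition geom (b : K) : S := fun al => b ^+ sumn al.
Definition geom_inv (b : K) : S := fun al =>
  \prod_(x <- al) (if x == 0%N then 1 else if x == 1%N then - b else 0).

Lemma trimmed_geom b : trimmed (geom b).
Proof. by apply: trimmedI => al; rewrite /geom sumn_trimz. Qed.

Lemma trimmed_geom_inv b : trimmed (geom_inv b).
Proof.
apply: trimmedI; rewrite /geom_inv; elim=> // a t IH; rewrite trimz_cons.
case: ifP => [/andP[/eqP-> /eqP e]|_]; last by rewrite !big_cons IH.
by rewrite big_cons -IH e !big_nil mulr1.
Qed.

Lemma conv_geom b al : conv (geom b) (geom_inv b) al = unit_series al.
Proof.
elim: al => [|a t IH] /=; first by rewrite /geom /geom_inv /unit_series big_nil expr0 mul1r.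
pose w x : K := if x == 0%N then 1 else if x == 1%N then - b else 0.
transitivity (\sum_(j < a.+1) (b ^+ j * w (a - j)%N) * conv (geom b) (geom_inv b) t).
  apply: eq_bigr => j _; rewrite -conv_scale; apply: eq_conv => s.
    by rewrite /geom /= exprD.
  by rewrite /geom_inv big_cons.
rewrite -mulr_suml IH /unit_series trimz_cons; case: a => [|a].
  by rewrite big_ord1 expr0 /w /= !mul1r; case: (trimz t).
rewrite /= !big_ord_recr /= big1 => [|j _].
  by rewrite subnn subSnn /w /= exprS; ring.
suff -> : w (a.+1 - j)%N = 0 by rewrite mulr0.
by rewrite /w; have := ltn_ord j; case e : (a.+1 - j)%N => [|[|?]] //; lia.
Qed.

End Convolution.

Section Series.
Variable n : nat.
Local Notation K := (Kfield n).
Local Notation S := (series n).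
Implicit Types (f g h : S) (c d : K).

Lemma smulE f g : smul f g = conv (f \o trimz) (g \o trimz).
Proof. by apply: functional_extensionality => al; rewrite -conv_mdivs. Qed.

Lemma trimmed_smul f g : trimmed (smul f g).
Proof.
by apply: trimmedI => al; rewrite smulE conv_trimz //; apply: trimmed_comp.
Qed.

Lemma smulC f g : smul f g = smul g f.
Proof. by rewrite !smulE; apply: functional_extensionality => al; rewrite convC. Qed.

Lemma smulA f g h : smul f (smul g h) = smul (smul f g) h.
Proof.
rewrite (smulE f (smul g h)) (smulE (smul f g) h) !trimmed_smul.
apply: functional_extensionality => al.
by rewrite !smulE convA.
Qed.

Lemma smul1 f : trimmed f -> smul (@sone n) f = f.
Proof.
move=> hf; rewrite smulE hf; apply: functional_extensionality => al.
rewrite -[RHS]conv_one; apply: eq_conv => // s; by rewrite /= /sone trimzK.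
Qed.

Lemma smulAC f g h : smul (smul f g) h = smul (smul f h) g.
Proof. by rewrite -!smulA (smulC g). Qed.

Lemma smulCA f g h : smul f (smul g h) = smul g (smul f h).
Proof. by rewrite !smulA (smulC f). Qed.

Lemma smulACA f g h k : smul (smul f g) (smul h k) = smul (smul f h) (smul g k).
Proof. by rewrite !smulA (smulAC f). Qed.

Lemma smul_lin c d f g g' :
  smul f (fun al => c * g al + d * g' al) = (fun al => c * smul f g al + d * smul f g' al).
Proof. by rewrite !smulE; apply: functional_extensionality => al; rewrite -conv_lin. Qed.

Lemma scoef_smul (phi : {rmorphism K -> K}) f g :
  scoef phi (smul f g) = smul (scoef phi f) (scoef phi g).
Proof. by rewrite !smulE; apply: functional_extensionality => al; rewrite /scoef conv_map. Qed.

Lemma trimmed_scoef (phi : K -> K) f : trimmed f -> trimmed (scoef phi f).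
Proof. by move=> hf; apply: trimmedI => al; rewrite /scoef trimmedE. Qed.

Lemma trimmed_one : trimmed (@sone n).
Proof. by apply: trimmedI => al; rewrite /sone trimzK. Qed.

Lemma scoef_one (phi : {rmorphism K -> K}) : scoef phi (@sone n) = @sone n.
Proof.
apply: functional_extensionality => al; rewrite /scoef /sone.
by case: ifP => _; [exact: rmorph1|exact: rmorph0].
Qed.

Lemma trimmed_Omega (b : K) : trimmed (Omega b).
Proof. exact: trimmed_geom. Qed.

Lemma trimmed_Omega_inv (b : K) : trimmed (Omega_inv b).
Proof. exact: trimmed_geom_inv. Qed.

Lemma scoef_Omega (phi : {rmorphism K -> K}) b : scoef phi (Omega b) = Omega (phi b).
Proof. by apply: functional_extensionality => al; rewrite /scoef /Omega; apply: rmorphXn. Qed.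

Lemma OmegaK (b : K) : smul (Omega b) (Omega_inv b) = @sone n.
Proof.
rewrite smulE trimmed_Omega trimmed_Omega_inv; apply: functional_extensionality.
exact: conv_geom.
Qed.

End Series.

(** * Demazure operators *)

Section Demazure.
Variable F : fieldType.
Implicit Types (sg ta : {rmorphism F -> F}) (x y z p q : F).

(** The action of p (sg - 1) + 1 on a single coefficient. *)
Definition dem (sg : F -> F) p x := p * sg x + (1 - p) * x.

Lemma dem_idem sg p x : (forall x, sg (sg x) = x) -> sg p = 1 - p ->
  dem sg p (dem sg p x) = dem sg p x.
Proof.
move=> sgK sp; rewrite /dem rmorphD !rmorphM rmorphB rmorph1 sp sgK; ring.
Qed.

Lemma dem_comm sg ta p q x : (forall x, sg (ta x) = ta (sg x)) -> sg q = q -> ta p = p ->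
  dem sg p (dem ta q x) = dem ta q (dem sg p x).
Proof.
by move=> c sq tp; rewrite /dem !rmorphD !rmorphM !rmorphB !rmorph1 sq tp c; ring.
Qed.

(** Here sg and ta permute x1, x2, x3 as adjacent transpositions. Both sides expand into the same
    products of sg and ta, with coefficients that agree as rational functions of x1, x2, x3. *)
Lemma dem_braid sg ta x1 x2 x3 p q x :
  (forall x, sg (sg x) = x) -> (forall x, ta (ta x) = x) ->
  (forall x, sg (ta (sg x)) = ta (sg (ta x))) ->
  sg x1 = x2 -> sg x2 = x1 -> sg x3 = x3 -> ta x1 = x1 -> ta x2 = x3 -> ta x3 = x2 ->
  x2 - x1 != 0 -> x3 - x1 != 0 -> x3 - x2 != 0 ->
  p = x2 / (x2 - x1) -> q = x3 / (x3 - x2) ->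
  dem sg p (dem ta q (dem sg p x)) = dem ta q (dem sg p (dem ta q x)).
Proof.
move=> sgK taK br s1 s2 s3 t1 t2 t3 n12 n13 n23 ep eq.
have sp : sg p = x1 / (x1 - x2) by rewrite ep fmorph_div rmorphB s1 s2.
have tp : ta p = x3 / (x3 - x1) by rewrite ep fmorph_div rmorphB t1 t2.
have sq : sg q = x3 / (x3 - x1) by rewrite eq fmorph_div rmorphB s2 s3.
have tq : ta q = x2 / (x2 - x3) by rewrite eq fmorph_div rmorphB t2 t3.
have stp : sg (ta p) = x3 / (x3 - x2) by rewrite tp fmorph_div rmorphB s1 s3.
have tsq : ta (sg q) = x2 / (x2 - x1) by rewrite sq fmorph_div rmorphB t1 t3.
rewrite /dem !(rmorphD, rmorphM, rmorphN, rmorph1) !sgK !taK br stp tsq sp sq tp tq ep eq.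
have n21 : x1 - x2 != 0 by rewrite -opprB oppr_eq0.
have n32 : x2 - x3 != 0 by rewrite -opprB oppr_eq0.
field; by rewrite ?n12 ?n13 ?n23 ?n21 ?n32.
Qed.

Lemma dem_weight x1 x2 : x2 != 0 -> (1 - x1 / x2)^-1 = x2 / (x2 - x1).
Proof.
move=> h; rewrite -[X in X - _](divff h) -mulrBl invfM invrK mulrC //.
Qed.

Lemma dem_weight_swap x1 x2 : x2 - x1 != 0 -> x1 / (x1 - x2) = 1 - x2 / (x2 - x1).
Proof.
move=> h; have h' : x1 - x2 != 0 by rewrite -opprB oppr_eq0.
by field; rewrite ?h ?h'.
Qed.

End Demazure.

Section Automorphisms.
Variable n : nat.
Hypothesis hn : (2 <= n)%N.
Local Notation K := (Kfield n).

(** Morphism structure exists only for maps that permute residues, so it is supplied on demand as a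
    packed morphism. *)
Lemma autK_rmorph pi pi' : modperm n pi pi' ->
  {phi : {rmorphism K -> K} | (phi : K -> K) = @autK n pi}.
Proof.
move=> h.
pose z := GRing.isZmodMorphism.Build K K (@autK n pi) (autK_additive hn h).
pose m := GRing.isMonoidMorphism.Build K K (@autK n pi) (autK_multiplicative hn h).
pose f : {rmorphism K -> K} := HB.pack (@autK n pi) z m.
by exists f.
Qed.

Lemma modperm_id : modperm n id id.
Proof. by split. Qed.

Lemma autK_comp pi1 pi1' pi2 pi2' pi3 pi3' pi4 pi4' x :
  modperm n pi1 pi1' -> modperm n pi2 pi2' -> modperm n pi3 pi3' -> modperm n pi4 pi4' ->
  (forall j, (pi1 (pi2 j) = pi3 (pi4 j) %[mod n])%N) ->
  autK pi1 (autK pi2 x) = autK pi3 (autK pi4 x) :> K.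
Proof.
move=> h1 h2 h3 h4 e.
have [f1 e1] := autK_rmorph h1; have [f2 e2] := autK_rmorph h2.
have [f3 e3] := autK_rmorph h3; have [f4 e4] := autK_rmorph h4.
have E : (f1 \o f2 : {rmorphism K -> K}) =1 (f3 \o f4 : {rmorphism K -> K}).
  apply: (rmorph_ea_eq hn) => j /=; rewrite e1 e2 e3 e4 !(autK_ea hn h1, autK_ea hn h2).
  rewrite !(autK_ea hn h3, autK_ea hn h4, autK_ea hn h1, autK_ea hn h2); exact: ea_mod.
by have := E x; rewrite /= e1 e2 e3 e4.
Qed.

Lemma autK_id x : autK id x = x :> K.
Proof.
have [f1 e1] := autK_rmorph modperm_id.
have E : f1 =1 (idfun : {rmorphism K -> K}).
  by apply: (rmorph_ea_eq hn) => j /=; rewrite e1 (autK_ea hn modperm_id).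
by have := E x; rewrite e1.
Qed.

Lemma autK_eq pi1 pi1' pi2 pi2' : modperm n pi1 pi1' -> modperm n pi2 pi2' ->
  (forall j, (pi1 j = pi2 j %[mod n])%N) -> @autK n pi1 = @autK n pi2.
Proof.
move=> h1 h2 e; apply: functional_extensionality => x.
have := autK_comp x h1 modperm_id h2 modperm_id e; by rewrite autK_id.
Qed.

Lemma modperm_add i : modperm n (fun j => j + i)%N (fun j => j + (n - i %% n))%N.
Proof.
have n0 : (0 < n)%N by exact: ltnW.
have E j : (j + i + (n - i %% n) = j %[mod n])%N.
  have := divn_eq i n; have := ltn_pmod i n0 => h1 h2.
  have -> : (j + i + (n - i %% n) = (i %/ n).+1 * n + j)%N by rewrite mulSn; lia.
  by rewrite modnMDl.
split=> [j k h|j k h|j|j].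
- by rewrite -modnDml h modnDml.
- by rewrite -modnDml h modnDml.
- by rewrite addnAC E.
- exact: E.
Qed.

Lemma swapn_mod a b a' b' j : (a = a' %[mod n])%N -> (b = b' %[mod n])%N ->
  (swapn n a b j = swapn n a' b' j %[mod n])%N.
Proof. by move=> ha hb; rewrite /swapn ha hb; case: ifP => // _; case: ifP. Qed.

Lemma swapnC a b j : (swapn n a b j = swapn n b a j %[mod n])%N.
Proof.
rewrite /swapn; case: (eqVneq (j %% n)%N (a %% n)%N) => [e|h]; last by case: ifP.
by case: (eqVneq (j %% n)%N (b %% n)%N) => // e'; rewrite -e -e'.
Qed.

Definition tr a b : K -> K := @autK n (swapn n a b).

Lemma tr_ea a b j : tr a b (ea n j) = ea n (swapn n a b j).
Proof. exact: (autK_ea hn (modperm_swapn n a b)). Qed.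

Lemma tr_mod a b a' b' : (a = a' %[mod n])%N -> (b = b' %[mod n])%N -> tr a b = tr a' b'.
Proof.
move=> ha hb; apply: (autK_eq (modperm_swapn n a b) (modperm_swapn n a' b')) => j.
exact: swapn_mod.
Qed.

Lemma trC a b : tr a b = tr b a.
Proof. apply: (autK_eq (modperm_swapn n a b) (modperm_swapn n b a)); exact: swapnC. Qed.

Lemma trK a b x : tr a b (tr a b x) = x.
Proof.
have h := modperm_swapn n a b; have [_ _ I _] := h.
by rewrite /tr (autK_comp x h h modperm_id modperm_id I) !autK_id.
Qed.

Lemma swapn_l a b : swapn n a b a = b.
Proof. by rewrite /swapn eqxx. Qed.

Lemma swapn_r a b : (swapn n a b b = a %[mod n])%N.
Proof. by rewrite swapnC swapn_l. Qed.

Lemma swapn_out a b j : (j %% n != a %% n)%N -> (j %% n != b %% n)%N -> swapn n a b j = j.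
Proof. by rewrite /swapn => /negPf-> /negPf->. Qed.

Lemma swapn_comm a b c d i : (a %% n != c %% n)%N -> (a %% n != d %% n)%N ->
  (b %% n != c %% n)%N -> (b %% n != d %% n)%N ->
  swapn n a b (swapn n c d i) = swapn n c d (swapn n a b i).
Proof.
move=> ac ad bc bd.
case: (eqVneq (i %% n)%N (a %% n)%N) => [e|ia].
  rewrite [swapn n c d i]swapn_out ?e // {1}/swapn e eqxx.
  by rewrite [swapn n a b i]/swapn e eqxx swapn_out.
case: (eqVneq (i %% n)%N (b %% n)%N) => [e|ib].
  rewrite [swapn n c d i]swapn_out ?e // /swapn e eqxx eq_sym in ia *.
  by rewrite (negPf ia) (negPf ac) (negPf ad).
rewrite [swapn n a b i]swapn_out // swapn_out // /swapn.
  by case: ifP => _; [rewrite eq_sym|case: ifP => _ //; rewrite eq_sym].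
by case: ifP => _; [rewrite eq_sym|case: ifP => _ //; rewrite eq_sym].
Qed.

Lemma tr_step a b c x : (a %% n != b %% n)%N -> (b %% n != c %% n)%N -> (a %% n != c %% n)%N ->
  tr a c (tr b c x) = tr b c (tr a b x).
Proof.
move=> ab bc ac; apply: autK_comp; try exact: modperm_swapn.
move=> j; have M := modperm_swapn n.
have [Mac _ _ _] := M a c; have [Mbc _ _ _] := M b c.
case: (eqVneq (j %% n)%N (a %% n)%N) => [e|ja].
  rewrite (Mac _ a) ?swapn_l; last by rewrite swapn_out // e.
  by rewrite (Mbc _ b) ?swapn_l // /swapn e eqxx.
case: (eqVneq (j %% n)%N (b %% n)%N) => [e|jb].
  rewrite (Mac _ c) ?swapn_r; last by rewrite /swapn e eqxx.
  have e' : (swapn n a b j = a %[mod n])%N.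
    by rewrite -swapnC /swapn e eqxx.
  by rewrite (Mbc _ _ e') swapn_out.
case: (eqVneq (j %% n)%N (c %% n)%N) => [e|jc].
  have e1 : (swapn n b c j = b %[mod n])%N by rewrite -swapnC /swapn e eqxx.
  rewrite (Mac _ _ e1) (swapn_out ja jb) (Mbc _ _ e) swapn_r swapn_out //.
  by rewrite eq_sym.
by rewrite (swapn_out jb jc) (swapn_out ja jc) (swapn_out ja jb) (swapn_out jb jc).
Qed.

(* The transpositions (j, j+1), j <> i, form a path through all residues. *)
Lemma tr_generated i x : (forall j, (j %% n != i %% n)%N -> tr j j.+1 x = x) ->
  tr i i.+1 x = x.
Proof.
move=> fixed.
have diff a m : (0 < m < n)%N -> (a %% n != (a + m) %% n)%N.
  move=> hm; apply/negP; rewrite -{1}[a]addn0 eqn_modDl mod0n modn_small; lia.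
have step m : (0 < m < n)%N -> tr i.+1 (i.+1 + m) x = x.
  elim: m => // m IH hm; case: m IH hm => [|m] IH hm.
    by rewrite addn1 fixed //; rewrite eq_sym -addn1; apply: diff; lia.
  have f1 : tr (i.+1 + m.+1) (i.+1 + m.+2) x = x.
    rewrite [(_ + m.+2)%N]addnS fixed // eq_sym.
    have -> : (i.+1 + m.+1 = i + m.+2)%N by lia.
    by apply: diff; lia.
  have := @tr_step i.+1 (i.+1 + m.+1) (i.+1 + m.+2) x.
  rewrite f1 IH ?f1; last lia.
  apply; first by apply: diff; lia.
    have -> : (i.+1 + m.+2 = i.+1 + m.+1 + 1)%N by lia.
    by apply: diff; lia.
  by apply: diff; lia.
rewrite trC -[RHS](step n.-1); last lia.
apply: (congr1 (fun f : K -> K => f x)); apply: tr_mod => //.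
have -> : (i.+1 + n.-1 = i + n)%N by lia.
by rewrite modnDr.
Qed.


Lemma scoef_autK_smul pi pi' (f g : series n) : modperm n pi pi' ->
  scoef (autK pi) (smul f g) = smul (scoef (autK pi) f) (scoef (autK pi) g).
Proof. by move=> /autK_rmorph[phi <-]; apply: scoef_smul. Qed.

Lemma scoef_autK_one pi pi' : modperm n pi pi' -> scoef (autK pi) (@sone n) = @sone n.
Proof. by move=> /autK_rmorph[phi <-]; apply: scoef_one. Qed.

Lemma autK_bb pi pi' j : modperm n pi pi' -> autK pi (bb n j) = bb n (pi j).
Proof.
move=> h; rewrite /bb -(autK_ea hn h); have [phi <-] := autK_rmorph h.
by rewrite rmorphB rmorph1 fmorphV.
Qed.

Lemma bb_mod j k : (j = k %[mod n])%N -> bb n j = bb n k.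
Proof. by rewrite /bb => /ea_mod ->. Qed.

Lemma scoef_autK_Omega pi pi' j : modperm n pi pi' ->
  scoef (autK pi) (Omega (bb n j)) = Omega (bb n (pi j)).
Proof.
move=> h; rewrite -(autK_bb j h); have [phi <-] := autK_rmorph h; exact: scoef_Omega.
Qed.

(** Both sides are inverse to the same Omega, so the coefficients are never inspected. *)
Lemma scoef_autK_Omega_inv pi pi' j : modperm n pi pi' ->
  scoef (autK pi) (Omega_inv (bb n j)) = Omega_inv (bb n (pi j)).
Proof.
move=> h; set w := Omega_inv (bb n (pi j)).
rewrite -[LHS]smul1; last exact/trimmed_scoef/trimmed_Omega_inv.
rewrite -(OmegaK (bb n (pi j))) -smulA [smul (Omega_inv _) _]smulC smulA.
rewrite -(scoef_autK_Omega j h) -(scoef_autK_smul _ _ h) OmegaK (scoef_autK_one h).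
by rewrite smul1 //; apply: trimmed_Omega_inv.
Qed.

Definition rho (j : nat) : K := (1 - ealpha n j)^-1.
(** D_j without the Omega factor of s_0; in this form the letter 0 is no exception and indices are
    cyclic. *)
Definition del j : K -> K := dem (tr j j.+1) (rho j).

Lemma rhoE j : rho j = ea n j.+1 / (ea n j.+1 - ea n j).
Proof.
have -> : rho j = (1 - ea n j / ea n j.+1)^-1.
  rewrite /rho /ealpha; case: eqP => // ->; congr (1 - _ / _)^-1.
  by apply: ea_mod; rewrite modnn mod0n.
by apply: dem_weight; apply: ea_neq0.
Qed.

Lemma ea_sub_neq0 j k : (j %% n != k %% n)%N -> ea n k - ea n j != 0.
Proof.
by move=> h; rewrite subr_eq0; apply: contra_neq h => /(ea_inj hn).
Qed.

Lemma modn_neq_succ j : (j %% n != j.+1 %% n)%N.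
Proof. by rewrite -addn1 -{1}[j]addn0 eqn_modDl mod0n modn_small. Qed.

Lemma rho_neq0 j : rho j != 0.
Proof.
rewrite rhoE mulf_neq0 ?ea_neq0 // invr_eq0; apply: ea_sub_neq0; exact: modn_neq_succ.
Qed.

Lemma tr_rmorph a b : {phi : {rmorphism K -> K} | (phi : K -> K) = tr a b}.
Proof. exact: autK_rmorph (modperm_swapn n a b). Qed.

Lemma del_idem j x : del j (del j x) = del j x.
Proof.
rewrite /del; have [phi e] := tr_rmorph j j.+1; rewrite -e; apply: dem_idem => [y|].
  by rewrite e trK.
rewrite rhoE -dem_weight_swap; last by apply: ea_sub_neq0; apply: modn_neq_succ.
rewrite fmorph_div rmorphB e !tr_ea swapn_l; congr (_ / (_ - _)); exact/ea_mod/swapn_r.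
Qed.

Lemma del_comm (j k : nat) x : (j < n)%N -> (k < n)%N ->
  ~~ (n %| k%:Z - j%:Z)%Z -> ~~ adj n j k -> ~~ adj n k j ->
  del j (del k x) = del k (del j x).
Proof.
have E (a b : nat) : (n %| b%:Z - a%:Z)%Z = (a %% n == b %% n)%N.
  by rewrite -eqz_mod_dvd !modz_nat eq_sym.
move=> hj hk h1 h2 h3.
have d1 : (j %% n != k %% n)%N by rewrite -E.
have d2 : (j.+1 %% n != k %% n)%N.
  by rewrite -E (_ : k%:Z - j.+1%:Z = k%:Z - j%:Z - 1) //; lia.
have d3 : (k.+1 %% n != j %% n)%N.
  by rewrite -E (_ : j%:Z - k.+1%:Z = j%:Z - k%:Z - 1) //; lia.
have d4 : (j.+1 %% n != k.+1 %% n)%N by rewrite -(addn1 j) -(addn1 k) eqn_modDr.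
have trfix a b : (a %% n != b %% n)%N -> (a.+1 %% n != b %% n)%N -> (b.+1 %% n != a %% n)%N ->
    (a.+1 %% n != b.+1 %% n)%N -> tr a a.+1 (rho b) = rho b.
  move=> e1 e2 e3 e4; rewrite rhoE; have [phi e] := tr_rmorph a a.+1.
  rewrite -e fmorph_div rmorphB e !tr_ea !swapn_out //; rewrite eq_sym //.
have C y : tr j j.+1 (tr k k.+1 y) = tr k k.+1 (tr j j.+1 y).
  apply: autK_comp; try exact: modperm_swapn; move=> i; congr (_ %% _)%N.
  by apply: swapn_comm => //; rewrite eq_sym.
rewrite /del; have [phi e] := tr_rmorph j j.+1; have [psi e'] := tr_rmorph k k.+1.
rewrite -e -e'; apply: dem_comm => [y||]; first by rewrite e e' C.
  by rewrite e; apply: trfix.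
by rewrite e'; apply: trfix => //; rewrite eq_sym.
Qed.


Lemma modn_neq_add a b c : (b < c)%N -> (c - b < n)%N -> ((a + b) %% n != (a + c) %% n)%N.
Proof.
move=> h1 h2; rewrite eqn_modDl; apply/negP => /eqP e.
have : (n %| c - b)%N by rewrite -eqn_mod_dvd ?e // ltnW.
by move/dvdn_leq; lia.
Qed.

Lemma tr_braid a b c x : (a %% n != b %% n)%N -> (b %% n != c %% n)%N -> (a %% n != c %% n)%N ->
  tr a b (tr b c (tr a b x)) = tr b c (tr a b (tr b c x)).
Proof.
move=> ab bc ac; rewrite -(tr_step (tr b c x) ab bc ac) trK.
rewrite eq_sym in ab; rewrite eq_sym in bc; rewrite eq_sym in ac.
have := tr_step (tr a b x) bc ab ac.
by rewrite (trC c a) (trC b a) (trC c b) trK => <-.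
Qed.

Lemma del_braid (j k : nat) x : (3 <= n)%N -> adj n j k ->
  del j (del k (del j x)) = del k (del j (del k x)).
Proof.
move=> hn3 hadj.
have ek : (k = j.+1 %[mod n])%N.
  apply/eqP; have := hadj; rewrite /adj (_ : k%:Z - j%:Z - 1 = k%:Z - j.+1%:Z); last by lia.
  by rewrite -eqz_mod_dvd !modz_nat.
have ek1 : (k.+1 = j.+2 %[mod n])%N by rewrite -(addn1 k) -modnDml ek modnDml addn1.
have tk : tr k k.+1 = tr j.+1 j.+2 by apply: tr_mod.
have d01 := @modn_neq_add j 0 1 isT; have d12 := @modn_neq_add j 1 2 isT.
have d02 := @modn_neq_add j 0 2 isT.
rewrite ?(addn0, addn1, addn2) in d01 d12 d02.
have {}d01 := d01 ltac:(lia); have {}d12 := d12 ltac:(lia); have {}d02 := d02 ltac:(lia).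
rewrite /del tk; have [phi e] := tr_rmorph j j.+1; have [psi e'] := tr_rmorph j.+1 j.+2.
rewrite -e -e'.
apply: (@dem_braid _ phi psi (ea n j) (ea n j.+1) (ea n j.+2)).
- by move=> y; rewrite e trK.
- by move=> y; rewrite e' trK.
- by move=> y; rewrite e e' tr_braid.
- by rewrite e tr_ea swapn_l.
- by rewrite e tr_ea; apply/ea_mod/swapn_r.
- by rewrite e tr_ea swapn_out // eq_sym.
- by rewrite e' tr_ea swapn_out.
- by rewrite e' tr_ea swapn_l.
- by rewrite e' tr_ea; apply/ea_mod/swapn_r.
- exact: ea_sub_neq0.
- exact: ea_sub_neq0.
- exact: ea_sub_neq0.
- by rewrite rhoE.
- by rewrite rhoE (ea_mod ek) (ea_mod ek1).
Qed.

End Automorphisms.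

(** * The operators on series and the products of Omega *)

Section Operators.
Variable n : nat.
Hypothesis hn : (2 <= n)%N.
Local Notation K := (Kfield n).
Implicit Types f g : series n.

(** As a_n = a_0, the reflection s_theta is the neighbour transposition of indices 0 and 1, which
    fits the pattern j, j + 1 of the other letters. *)
Lemma s_act0 f : s_act 0 f =
  smul (smul (Omega (bb n 1)) (Omega_inv (bb n n))) (scoef (@tr n 0 1) f).
Proof.
rewrite /s_act /=; congr (smul _ (scoef _ _)).
apply: (autK_eq hn (modperm_swapn n 1 n) (modperm_swapn n 0 1)) => j.
by rewrite swapnC; apply: swapn_mod => //; rewrite modnn mod0n.
Qed.

Lemma s_actS j f : (0 < j)%N -> s_act j f = scoef (@tr n j j.+1) f.
Proof. by case: j. Qed.

Lemma D_opE j f : D_op j f = (fun al => rho n j * s_act j f al + (1 - rho n j) * f al).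
Proof.
apply: functional_extensionality => al; rewrite /D_op /T_op -/(rho n j).
by rewrite mulrBr mulrBl mul1r addrA addrAC.
Qed.

Lemma trimmed_s_act j f : trimmed f -> trimmed (s_act j f).
Proof.
by move=> hf; rewrite /s_act; case: eqP => _; [apply: trimmed_smul|apply: trimmed_scoef].
Qed.

Lemma trimmed_D_op j f : trimmed f -> trimmed (D_op j f).
Proof.
move=> hf; rewrite D_opE; apply: trimmedI => al.
by rewrite (trimmedE al hf) (trimmedE al (trimmed_s_act j hf)).
Qed.

Fixpoint prodOmega (i : nat) : series n :=
  if i is i'.+1 then smul (prodOmega i') (Omega (bb n i)) else @sone n.
Fixpoint prodOmega_inv (i : nat) : series n :=
  if i is i'.+1 then smul (prodOmega_inv i') (Omega_inv (bb n i)) else @sone n.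

Local Notation H := prodOmega.
Local Notation Hi := prodOmega_inv.

Lemma smul_one_l f g : smul (smul (@sone n) f) g = smul f g.
Proof. by rewrite -smulA smul1 //; apply: trimmed_smul. Qed.

Lemma prodOmegaK i : smul (H i) (Hi i) = @sone n.
Proof.
elim: i => [|i IH] /=; first by rewrite smul1 //; apply: trimmed_one.
by rewrite smulACA IH OmegaK smul1 //; apply: trimmed_one.
Qed.

Lemma trimmed_prodOmega i : trimmed (H i).
Proof. by case: i => [|i]; [apply: trimmed_one|apply: trimmed_smul]. Qed.

Lemma tr_smul a b f g :
  scoef (@tr n a b) (smul f g) = smul (scoef (@tr n a b) f) (scoef (@tr n a b) g).
Proof. exact: (scoef_autK_smul hn _ _ (modperm_swapn n a b)). Qed.

Lemma tr_Omega a b j : scoef (@tr n a b) (Omega (bb n j)) = Omega (bb n (swapn n a b j)).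
Proof. exact: (scoef_autK_Omega hn _ (modperm_swapn n a b)). Qed.

Lemma tr_one a b : scoef (@tr n a b) (@sone n) = @sone n.
Proof. exact: (scoef_autK_one hn (modperm_swapn n a b)). Qed.

Lemma prodOmega_tr_lt i j : (i < j < n)%N -> scoef (@tr n j j.+1) (H i) = H i.
Proof.
elim: i => [|i IH] hij /=; first exact: tr_one.
rewrite tr_smul tr_Omega IH; last lia.
have e1 : (i.+1 %% n = i.+1)%N by apply: modn_small; lia.
rewrite swapn_out // e1; first by rewrite modn_small; lia.
have [->|ne] := eqVneq j.+1 n; first by rewrite modnn.
by rewrite modn_small; lia.
Qed.

Lemma prodOmega_tr i j : (0 < j < n)%N -> (i < n)%N -> j != i ->
  scoef (@tr n j j.+1) (H i) = H i.
Proof.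
elim: i => [|i IH] hj hi ji /=; first exact: tr_one.
have [lt|ge] := ltnP i.+1 j; first by apply: (@prodOmega_tr_lt i.+1); lia.
have [e|ne] := eqVneq j i; last first.
  rewrite tr_smul tr_Omega IH //; last lia.
  by rewrite swapn_out // !modn_small; lia.
case: i e hi ge {IH ji} => [|i] e hi ge; first by lia.
rewrite /= !tr_smul !tr_Omega e prodOmega_tr_lt; last lia.
by rewrite swapn_l (bb_mod (swapn_r n _ _)) smulAC.
Qed.

Lemma prodOmega_tr_last i : (0 < i < n)%N ->
  smul (scoef (@tr n i i.+1) (H i)) (Omega (bb n i)) = smul (H i) (Omega (bb n i.+1)).
Proof.
case: i => // i hi; rewrite /= tr_smul tr_Omega prodOmega_tr_lt; last lia.
by rewrite swapn_l smulAC.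
Qed.

(** The exchange of a_1 and a_n replaces the factor of b_1 by that of b_n, which is what the twist
    in s_0 compensates. *)
Lemma prodOmega_tr0 i : (0 < i < n)%N ->
  smul (scoef (@tr n 0 1) (H i)) (Omega (bb n 1)) = smul (H i) (Omega (bb n n)).
Proof.
elim: i => // i IH hi; have [->|i0] := eqVneq i 0%N.
  rewrite /= tr_smul tr_Omega tr_one !smul_one_l (bb_mod (swapn_r n 0 1)) smulC.
  by congr (smul _ (Omega _)); apply: bb_mod; rewrite modnn mod0n.
have hi' : (0 < i < n)%N by lia.
have si : swapn n 0 1 i.+1 = i.+1 by apply: swapn_out; rewrite !modn_small; lia.
by rewrite /= tr_smul tr_Omega si smulAC (IH hi') smulAC.
Qed.

End Operators.

(** * Factorization *)

Section Factorization.
Variable n : nat.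
Hypothesis hn : (2 <= n)%N.
Local Notation K := (Kfield n).
Implicit Types f g : series n.
Local Notation H := (@prodOmega n).
Local Notation Hi := (@prodOmega_inv n).
Local Notation sg j := (scoef (@tr n j j.+1)).

(* Conjugating by [prodOmega i] turns s_0 into a mere permutation of the coefficients,
   and does not affect the other s_j with j <> i. *)
Lemma s_act_conj i j f : (0 < i < n)%N -> (j < n)%N -> j != i -> trimmed f ->
  s_act j f = smul (H i) (sg j (smul (Hi i) f)).
Proof.
move=> hi hj ji hf; have HK := prodOmegaK n i.
have tHK : smul (sg j (H i)) (sg j (Hi i)) = @sone n by rewrite -tr_smul // HK tr_one.
move: tHK; have [->|j0] := eqVneq j 0%N => tHK.
  rewrite s_act0 // tr_smul // smulA; congr smul.
  have e : H i = smul (smul (sg 0 (H i)) (Omega (bb n 1))) (Omega_inv (bb n n)).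
    rewrite prodOmega_tr0 // -smulA OmegaK smulC smul1 //; exact: trimmed_prodOmega.
  by rewrite [in RHS]e smulAC [smul (smul _ _) (sg 0 (Hi i))]smulAC tHK smul_one_l.
have j0' : (0 < j)%N by rewrite lt0n.
rewrite s_actS // tr_smul // smulA -{1}(@prodOmega_tr n hn i j) //; try lia.
by rewrite tHK smul1 //; apply: trimmed_scoef.
Qed.

Lemma smul_prodOmega i f : trimmed f -> smul (H i) (smul (Hi i) f) = f.
Proof. by move=> hf; rewrite smulA prodOmegaK smul1. Qed.

Lemma smul_prodOmega_inv i f : trimmed f -> smul (Hi i) (smul (H i) f) = f.
Proof. by move=> hf; rewrite smulA [smul (Hi i) _]smulC prodOmegaK smul1. Qed.

Lemma D_op_conj i j f : (0 < i < n)%N -> (j < n)%N -> j != i -> trimmed f ->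
  D_op j f = smul (H i) (scoef (@del n j) (smul (Hi i) f)).
Proof.
move=> hi hj ji hf; rewrite D_opE (s_act_conj hi hj ji hf).
rewrite -{2}(smul_prodOmega i hf) -(smul_lin (rho n j) (1 - rho n j)).
by [].
Qed.

Lemma D_opS j f : (0 < j)%N -> D_op j f = scoef (@del n j) f.
Proof. by move=> j0; rewrite D_opE s_actS. Qed.

(** A relation between two letters can be transferred to the untwisted [del] only if one factor
    conjugates both. If a letter is 0, n >= 3 leaves an index i in 1, ..., n - 1 different from
    both; otherwise no twist occurs and the factor is 1. *)
Lemma D_op_conj2 (k j : nat) : (3 <= n)%N -> (k < n)%N -> (j < n)%N -> k != j ->
  exists h h', [/\ smul h h' = @sone n,
    forall f, trimmed f -> D_op k f = smul h (scoef (@del n k) (smul h' f)) &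
    forall f, trimmed f -> D_op j f = smul h (scoef (@del n j) (smul h' f))].
Proof.
move=> hn3 hk hj kj.
have [j0|j0] := posnP j.
  have [i [hi ik]] : exists i, (0 < i < n)%N /\ k != i.
    by exists (if k == 1 then 2 else 1)%N; case: eqP => // e; lia.
  exists (H i), (Hi i); split=> [|f hf|f hf]; first exact: prodOmegaK.
    exact: D_op_conj.
  by apply: D_op_conj => //; lia.
have [k0|k0] := posnP k.
  have [i [hi ij]] : exists i, (0 < i < n)%N /\ j != i.
    by exists (if j == 1 then 2 else 1)%N; case: eqP => // e; lia.
  exists (H i), (Hi i); split=> [|f hf|f hf]; first exact: prodOmegaK.
    by apply: D_op_conj => //; lia.
  exact: D_op_conj.
exists (@sone n), (@sone n); split=> [|f hf|f hf]; first exact/smul1/trimmed_one.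
  by rewrite D_opS // !smul1 //; apply: trimmed_scoef.
by rewrite D_opS // !smul1 //; apply: trimmed_scoef.
Qed.

Lemma smul_cancel h h' f : smul h h' = @sone n -> trimmed f -> smul h' (smul h f) = f.
Proof. by move=> e hf; rewrite smulA [smul h' h]smulC e smul1. Qed.

Lemma D_op_idem j f : (j < n)%N -> trimmed f -> D_op j (D_op j f) = D_op j f.
Proof.
move=> hj hf; have [->|j0] := eqVneq j 0%N; last first.
  rewrite -lt0n in j0; rewrite !D_opS //; apply: functional_extensionality => al.
  exact: del_idem.
have h1 : (0 < 1 < n)%N by lia.
have h0 : (0 < n)%N by lia.
have t := trimmed_smul (H 1) (scoef (@del n 0) (smul (Hi 1) f)).
rewrite !(@D_op_conj 1 0) // smul_prodOmega_inv; last exact/trimmed_scoef/trimmed_smul.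
by congr smul; apply: functional_extensionality => al; apply: del_idem.
Qed.

Lemma D_op_comm (k j : nat) f : (k < n)%N -> (j < n)%N ->
  ~~ (n %| j%:Z - k%:Z)%Z -> ~~ adj n k j -> ~~ adj n j k -> trimmed f ->
  D_op k (D_op j f) = D_op j (D_op k f).
Proof.
move=> hk hj h1 h2 h3 hf.
have kj : k != j by apply: contraNneq h1 => ->; rewrite subrr dvdz0.
have hn3 : (3 <= n)%N.
  rewrite ltnNge; apply/negP => n2; have en : n = 2%N by lia.
  move: h2 h3; rewrite /adj en; case: k j hk hj kj {h1} => [|[|k]] [|[|j]]; lia.
have [h [h' [hh Dk Dj]]] := D_op_conj2 hn3 hk hj kj.
have t m : trimmed (scoef (@del n m) (smul h' f)) by exact/trimmed_scoef/trimmed_smul.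
rewrite (Dj f hf) (Dk f hf) (Dk _ (trimmed_smul _ _)) (Dj _ (trimmed_smul _ _)).
rewrite !(smul_cancel hh) //; congr smul; apply: functional_extensionality => al.
exact: del_comm.
Qed.

Lemma D_op_braid (k j : nat) f : (3 <= n)%N -> (k < n)%N -> (j < n)%N -> adj n k j -> trimmed f ->
  D_op k (D_op j (D_op k f)) = D_op j (D_op k (D_op j f)).
Proof.
move=> hn3 hk hj hadj hf.
have kj : k != j.
  apply: contraTneq hadj => ->; rewrite /adj (_ : j%:Z - j%:Z - 1 = - 1); last by lia.
  by rewrite (@ndvd_small n hn (-1)) //; lia.
have [h [h' [hh Dk Dj]]] := D_op_conj2 hn3 hk hj kj.
have t m f' : trimmed (scoef (@del n m) (smul h' f')) by exact/trimmed_scoef/trimmed_smul.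
have t3 m m' f' : trimmed (scoef (@del n m) (scoef (@del n m') (scoef (@del n m) (smul h' f')))).
  by do 2 apply: trimmed_scoef.
have DD m f' : trimmed f' -> forall a,
    (forall f, trimmed f -> D_op a f = smul h (scoef (@del n a) (smul h' f))) ->
    D_op a (smul h (scoef (@del n m) f')) = smul h (scoef (@del n a) (scoef (@del n m) f')).
  by move=> tf a Da; rewrite Da ?(smul_cancel hh) //; [apply: trimmed_scoef|apply: trimmed_smul].
have tf := trimmed_smul h' f.
rewrite (Dk f hf) (Dj f hf) (DD _ _ tf _ Dj) (DD _ _ tf _ Dk).
rewrite (DD _ _ (t k f) _ Dk) ?(DD _ _ (trimmed_scoef _ (t k f)) _ Dk).
rewrite (DD _ _ (t j f) _ Dj).
congr smul; apply: functional_extensionality => al.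
exact: del_braid.
Qed.

Lemma s_act_one j : (0 < j)%N -> s_act j (@sone n) = @sone n.
Proof. by move=> j0; rewrite s_actS // tr_one. Qed.

Lemma D_op_one j : (0 < j < n)%N -> D_op j (@sone n) = @sone n.
Proof.
case/andP=> j0 _; rewrite D_opE s_act_one //; apply: functional_extensionality => al.
by rewrite -mulrDl addrCA subrr addr0 mul1r.
Qed.

Lemma D_op_fixed j f : D_op j f = f -> s_act j f = f.
Proof.
rewrite D_opE => e; apply: functional_extensionality => al.
have := congr1 (fun F : series n => F al) e; move/eqP => /=.
rewrite mulrBl mul1r addrA addrAC -subr_eq0 addrK -mulrBr mulf_eq0 (negPf (rho_neq0 hn j)) /=.
by rewrite subr_eq0 => /eqP.
Qed.

Lemma iter_omega_s m f : iter m (@omega_s n) f = scoef (autK (fun j => j + m)%N) f.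
Proof.
elim: m => [|m IH] /=.
  apply: functional_extensionality => al; rewrite /scoef -[LHS](autK_id hn).
  apply: (congr1 (fun F : K -> K => F _)).
  by apply: (autK_eq hn (modperm_id n) (modperm_add hn 0)) => j; rewrite addn0.
rewrite IH; apply: functional_extensionality => al; rewrite /omega_s /scoef.
rewrite -[in RHS](autK_id hn (f al)).
apply: (autK_comp hn _ (modperm_succ hn) (modperm_add hn m) (modperm_add hn m.+1)
  (modperm_id n)) => j.
by rewrite addnS.
Qed.

(** * Multiplication by a series fixed by every s_j with j <> i *)

Section Factor.
Variables (i : nat) (g : series n).
Hypothesis hi : (0 < i < n)%N.
Hypothesis hg : trimmed g.
Hypothesis fixg : forall j, (j < n)%N -> j != i -> s_act j g = g.

(* The coefficients of [Hi i * g] are invariant under all of S_n. *)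
Lemma s_act_rect : sg i g = smul (smul (Omega (bb n i.+1)) (Omega_inv (bb n i))) g.
Proof.
have fixG : sg i (smul (Hi i) g) = smul (Hi i) g.
  apply: functional_extensionality => al; apply: (tr_generated hn) => j hj.
  have jn : (j %% n < n)%N by rewrite ltn_pmod; lia.
  have ji : (j %% n)%N != i by apply: contraNneq hj => ->; rewrite modn_small //; lia.
  have := fixg jn ji; rewrite (s_act_conj hi jn ji hg) => /(congr1 (smul (Hi i))).
  rewrite smul_prodOmega_inv; last exact/trimmed_scoef/trimmed_smul.
  move/(congr1 (fun F : series n => F al)) => e.
  have -> : @tr n j j.+1 = tr (j %% n) (j %% n).+1.
    by apply: (tr_mod hn); rewrite ?modn_mod // -(addn1 j) -(addn1 (j %% n)) modnDml.
  exact: e.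
rewrite -{1}(smul_prodOmega i hg) tr_smul // fixG.
have e : sg i (H i) = smul (smul (H i) (Omega (bb n i.+1))) (Omega_inv (bb n i)).
  rewrite -prodOmega_tr_last // -smulA OmegaK smulC smul1 //.
  exact/trimmed_scoef/trimmed_prodOmega.
rewrite e -[smul (smul (H i) _) _]smulA [smul (H i) (smul _ _)]smulC -smulA.
by rewrite smul_prodOmega.
Qed.

Definition shf : K -> K := @autK n (fun j => j + i)%N.

Lemma shf_smul f f' : scoef shf (smul f f') = smul (scoef shf f) (scoef shf f').
Proof. exact: (scoef_autK_smul hn _ _ (modperm_add hn i)). Qed.

Lemma iter_omega f : iter i (@omega_s n) f = scoef shf f.
Proof. exact: iter_omega_s. Qed.

Lemma shf_tr k f : scoef shf (sg k f) = sg ((k + i) %% n)%N (scoef shf f).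
Proof.
apply: functional_extensionality => al; rewrite /scoef.
apply: (autK_comp hn _ (modperm_add hn i) (modperm_swapn n _ _) (modperm_swapn n _ _)
  (modperm_add hn i)) => j.
have e1 : (k + i = (k + i) %% n %[mod n])%N by rewrite modn_mod.
have e2 : (k.+1 + i = ((k + i) %% n).+1 %[mod n])%N.
  by rewrite addSn -(addn1 (k + i)) -(addn1 (_ %% _)) modnDml.
rewrite -(swapn_mod (j + i) e1 e2) /swapn !eqn_modDr.
by case: ifP => // _; case: ifP.
Qed.

Lemma shf_rho k : shf (rho n k) = rho n ((k + i) %% n).
Proof.
have [phi e] := autK_rmorph hn (modperm_add hn i).
rewrite !rhoE // /shf -e fmorph_div rmorphB e !(autK_ea hn (modperm_add hn i)).
have e1 : (k + i = (k + i) %% n %[mod n])%N by rewrite modn_mod.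
have e2 : (k.+1 + i = ((k + i) %% n).+1 %[mod n])%N.
  by rewrite addSn -(addn1 (k + i)) -(addn1 (_ %% _)) modnDml.
by rewrite (ea_mod e1) (ea_mod e2).
Qed.

Lemma s_act_shift k f : (k < n)%N -> trimmed f ->
  s_act ((k + i) %% n)%N (smul (scoef shf f) g) = smul (scoef shf (s_act k f)) g.
Proof.
move=> hk hf; have [->|k0] := eqVneq k 0%N.
  rewrite add0n modn_small; last lia.
  rewrite s_actS; last lia.
  rewrite tr_smul // s_act_rect s_act0 // !shf_smul.
  rewrite /shf (scoef_autK_Omega hn _ (modperm_add hn i)).
  rewrite (scoef_autK_Omega_inv hn _ (modperm_add hn i)) -/shf shf_tr.
  rewrite add0n modn_small; last lia.
  rewrite add1n (bb_mod (modnDl i n)).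
  by rewrite smulA [smul (sg i _) _]smulC.
have k'n : ((k + i) %% n < n)%N by rewrite ltn_pmod; lia.
have k'i : ((k + i) %% n)%N != i.
  apply: contraNneq k0 => e; have : (k + i == 0 + i %[mod n])%N.
    by rewrite add0n -[X in _ == (X %% _)%N]e modn_mod.
  by rewrite eqn_modDr mod0n modn_small.
rewrite [in RHS]s_actS ?lt0n // shf_tr.
set k' := ((k + i) %% n)%N in k'n k'i *; have := fixg k'n k'i.
(* If k + i = n the shifted letter is 0 and brings a twist; it is absorbed by g, which s_0 fixes. *)
have [->|k'0] := eqVneq k' 0%N.
  rewrite !s_act0 // tr_smul // => e.
  by rewrite smulCA e.
by rewrite !s_actS ?lt0n // tr_smul // => ->.
Qed.

Lemma D_op_shift k f : (k < n)%N -> trimmed f ->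
  D_op ((k + i) %% n)%N (smul (scoef shf f) g) = smul (scoef shf (D_op k f)) g.
Proof.
move=> hk hf; have [phi e] := autK_rmorph hn (modperm_add hn i).
rewrite D_opE s_act_shift // D_opE.
have -> : scoef shf (fun al => rho n k * s_act k f al + (1 - rho n k) * f al) =
    (fun al => rho n ((k + i) %% n) * scoef shf (s_act k f) al
             + (1 - rho n ((k + i) %% n)) * scoef shf f al).
  apply: functional_extensionality => al; rewrite -shf_rho /scoef /shf -e.
  by rewrite rmorphD !rmorphM rmorphB rmorph1.
rewrite [RHS]smulC smul_lin; apply: functional_extensionality => al.
by rewrite ![smul g _]smulC.
Qed.

Lemma D_word_shift w : all (fun k => k < n)%N w ->
  D_word (shiftw n i w) g = smul (scoef shf (D_word w (@sone n))) g.
Proof.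
elim: w => [_|k w IH /= /andP[hk hw]] /=.
  by rewrite /shf (scoef_autK_one hn (modperm_add hn i)) smul1.
rewrite IH // D_op_shift //.
have : forall v, trimmed (D_word v (@sone n)).
  by elim=> [|? ? ?]; [apply: trimmed_one|apply: trimmed_D_op].
exact.
Qed.

End Factor.
End Factorization.

Lemma ascending_letters n w : ascending n w -> all (fun k => k < n)%N w.
Proof. by elim: w => //= k w IH /and3P[-> /IH]. Qed.

Theorem theorem6p1 (n : nat) (hn : (2 <= n)%N) (la : seq nat) (i : nat) :
  is_partition la -> k_bounded n.-1 la -> (1 <= i <= n.-1)%N ->
  forall w_la w_un w_R : seq nat,
    word_of_partition n w_la la ->
    word_of_partition n w_un (part_union la (rect_part n i)) ->
    word_of_partition n w_R (rect_part n i) ->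
    forall al : seq nat,
      gtilde n w_un al = smul (iter i (@omega_s n) (gtilde n w_la)) (gtilde n w_R) al.
Proof.
move=> hla _ hi' wl wu wR hl hu hR al.
have hi : (0 < i < n)%N by lia.
have [hwl _ _] := rep_core hn (proj1 (andP hl)).
have [hwu _ _] := rep_core hn (proj1 (andP hu)).
have [hwR _ _] := rep_core hn (proj1 (andP hR)).
pose good := @trimmed (Kfield n).
have g0 : good (@sone n) by apply: trimmed_one.
have gD k (f : series n) : good f -> good (D_op k f) by apply: trimmed_D_op.
have Dc := @D_op_comm n hn; have Db := @D_op_braid n hn.
have E : gtilde n wu = gtilde n (shiftw n i wl ++ wR).
  apply: (run_unique hn g0 gD Dc Db) => //; first exact: ascending_shiftw.
  exact: (union_lvl hn hi hR hla hl hu).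
have stable j : (j < n)%N -> j != i -> s_act j (gtilde n wR) = gtilde n wR.
  move=> hj ji; apply: (D_op_fixed hn).
  apply: (run_stable hn g0 gD Dc Db (@D_op_one n hn) (@D_op_idem n hn)) => //.
  exact: (rect_stable hn hi hR hj ji).
have tg : trimmed (gtilde n wR) by apply: (good_run g0 gD).
have -> : gtilde n wu = D_word (shiftw n i wl) (gtilde n wR).
  by rewrite E /gtilde /D_word foldr_cat.
by rewrite (D_word_shift hn hi tg stable) ?iter_omega // (ascending_letters hwl).
Qed.
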